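(* Let $\alpha\ge 0$, $1\le s\le\infty$, $1\le p\le\infty$, $\mu>1-1/s$, $\mu>0$ (with $1/\infty=0$). Write $R_{N,\delta}=R_{N,\delta}(W^\mu_s,\Psi_N,C,\ell_p)$ for integers $N\ge1$ and $0<\delta<1$. The most economical (in order) choice of $N$ is $N_{\min}\asymp\delta^{-\frac1{\mu-1/p+1/s}}$, in the following sense. (1) For any choice of integers $N_{\min}=N_{\min}(\delta)\ge1$ with $N_{\min}\asymp\delta^{-\frac1{\mu-1/p+1/s}}$ for $0<\delta<1$, $$\inf_{N\ge1}R_{N,\delta}\asymp R_{N_{\min},\delta}\asymp\delta^{\frac{\mu+1/s-1}{\mu-1/p+1/s}}\qquad(0<\delta<1).$$ (2) If integers $N(\delta)\ge1$ satisfy $R_{N(\delta),\delta}\asymp\inf_{N\ge1}R_{N,\delta}$ for $0<\delta<1$, then there is a constant $c>0$ such that $N(\delta)\ge c\,\delta^{-\frac1{\mu-1/p+1/s}}$ for all $0<\delta<1$. The constants do not depend on $\delta$.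
   Context: Let $w(t)=t^\alpha e^{-t}$ on $(0,\infty)$, and let $L_{2,w}$ be the real Hilbert space of functions square-summable with weight $w$, with $\langle f,g\rangle=\int_0^\infty t^\alpha e^{-t}f(t)g(t)\,dt$. The Laguerre polynomials are $L_k^{(\alpha)}(t)=\sum_{m=0}^k\frac{\Gamma(k+\alpha+1)}{\Gamma(m+\alpha+1)(k-m)!}\frac{(-t)^m}{m!}$, and $\ell_k^{(\alpha)}=\left(\frac{k!}{\Gamma(k+\alpha+1)}\right)^{1/2}L_k^{(\alpha)}$, $k\in\mathbb N_0=\{0,1,2,\dots\}$. $C$ is the space of real-valued continuous functions on $(0,\infty)$, with $\|g\|_C=\sup_{t>0}|g(t)|\in[0,\infty]$. $\ell_p$ is the usual sequence space on $\mathbb N_0$. For $f\in L_{2,w}$, $\mathbf f=(\langle f,\ell_k^{(\alpha)}\rangle)_{k\in\mathbb N_0}\in\ell_2$. For $\mu>0$ and $\underline k=\max\{1,k\}$: $\|f\|_{s,\mu}^s=\sum_{k=0}^\infty\underline k^{s\mu}|\langle f,\ell_k^{(\alpha)}\rangle|^s$ for $1\le s<\infty$, $\|f\|_{\infty,\mu}=\sup_k\underline k^\mu|\langle f,\ell_k^{(\alpha)}\rangle|$. The function class is $W^\mu_s=\{f\in L_{2,w}:\|f\|_{s,\mu}\le1\}$. For $\mu>1-1/s$ and $f\in W^\mu_s$, $f\sqrt w$ is identified with its continuous representative $\sum_k\langle f,\ell_k^{(\alpha)}\rangle\ell_k^{(\alpha)}\sqrt w$ (absolutely and uniformly convergent).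 For finite $\Omega\subset\mathbb N_0$, $G_\Omega:L_{2,w}\to\ell_2$ maps $f$ to the sequence whose $k$-th entry is $\langle f,\ell_k^{(\alpha)}\rangle$ if $k\in\Omega$ and $0$ otherwise. A recovery operator is any mapping $\psi:\ell_2\to C$. $\Psi_N$ is the set of all $\psi G_\Omega$ with $\operatorname{card}(\Omega)\le N$. For a map $A:L_{2,w}\to C$, $$e_\delta(W^\mu_s,A,C,\ell_p)=\sup_{f\in W^\mu_s}\ \sup_{f^\delta\in L_{2,w}:\|\mathbf f^\delta-\mathbf f\|_{\ell_p}\le\delta}\|(f-A(f^\delta))\sqrt w\|_C,$$ and $R_{N,\delta}(W^\mu_s,\Psi_N,C,\ell_p)=\inf_{A\in\Psi_N}e_\delta(W^\mu_s,A,C,\ell_p)$ is the minimal radius of Galerkin information. $A\asymp B$ means each of $A,B$ is bounded by a positive constant times the other. *)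

(* Defs.v *)
From HB Require Import structures.
From mathcomp Require Import all_boot all_order all_algebra finmap.
From mathcomp Require Import all_classical all_reals all_analysis.

Set Implicit Arguments.
Unset Strict Implicit.
Unset Printing Implicit Defensive.

Import Order.TTheory GRing.Theory Num.Theory.
Import numFieldNormedType.Exports.

Local Open Scope classical_set_scope.
Local Open Scope ring_scope.

Definition halfline (R : realType) : set R := [set` `]0, +oo[].
Arguments halfline {R}.

(* Euler's integral; it is only used at arguments x >= 1. *)
Definition Gamma (R : realType) (x : R) : R :=
  \int[lebesgue_measure]_(t in halfline) (t `^ (x - 1) * expR (- t)).

Definition weight (R : realType) (alpha t : R) : R := t `^ alpha * expR (- t).

(* Functions on (0, oo) are total functions R -> R whose values outside
   (0, oo) are never used.  L_{2,w} is given by its representatives: everything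
   below depends on f only through the Fourier-Laguerre coefficients
   [coef alpha f], hence only on its class modulo a.e. equality. *)
Definition L2w (R : realType) (alpha : R) : set (R -> R) :=
  [set f : R -> R | measurable_fun halfline f /\
    lebesgue_measure.-integrable halfline
      (fun t => (weight alpha t * f t ^+ 2)%:E)].

Definition inner (R : realType) (alpha : R) (f g : R -> R) : R :=
  \int[lebesgue_measure]_(t in halfline) (weight alpha t * f t * g t).

Definition laguerre (R : realType) (alpha : R) (k : nat) (t : R) : R :=
  \sum_(m < k.+1)
     Gamma (k%:R + alpha + 1) / (Gamma (m%:R + alpha + 1) * (k - m)`!%:R)
     * ((- t) ^+ m / m`!%:R).

Definition nlaguerre (R : realType) (alpha : R) (k : nat) (t : R) : R :=
  Num.sqrt (k`!%:R / Gamma (k%:R + alpha + 1)) * laguerre alpha k t.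

Definition coef (R : realType) (alpha : R) (f : R -> R) (k : nat) : R :=
  inner alpha f (nlaguerre alpha k).

(* The norm of l_p, 1 <= p <= +oo, is the L_p norm of the counting measure. *)
Definition lnorm (R : realType) (p : \bar R) (x : nat -> R) : \bar R :=
  ('N[counting]_p[EFin \o x])%E.

Definition ell2 (R : realType) : set (nat -> R) :=
  [set x : nat -> R | (lnorm 2%:E x < +oo)%E].
Arguments ell2 {R}.

Definition wnorm (R : realType) (alpha : R) (s : \bar R) (mu : R)
    (f : R -> R) : \bar R :=
  lnorm s (fun k => (maxn 1 k)%:R `^ mu * `|coef alpha f k|).

Definition Wclass (R : realType) (alpha : R) (s : \bar R) (mu : R) :
    set (R -> R) :=
  [set f : R -> R | L2w alpha f /\ (wnorm alpha s mu f <= 1)%E].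

(* The continuous representative of f * sqrt w. *)
Definition crep (R : realType) (alpha : R) (f : R -> R) (t : R) : R :=
  limn (series (fun k =>
    coef alpha f k * nlaguerre alpha k t * Num.sqrt (weight alpha t))).

Definition spaceC (R : realType) : set (R -> R) :=
  [set g : R -> R | {within halfline, continuous g}].
Arguments spaceC {R}.

Definition normC (R : realType) (g : R -> R) : \bar R :=
  ereal_sup [set `|g t|%:E | t in halfline].

Definition galerkin (R : realType) (alpha : R) (Omega : {fset nat})
    (f : R -> R) : nat -> R :=
  fun k => if k \in Omega then coef alpha f k else 0.

Definition Psi (R : realType) (alpha : R) (N : nat) :
    set ((R -> R) -> (R -> R)) :=
  [set A | exists (Omega : {fset nat}) (psi : (nat -> R) -> (R -> R)),
    [/\ (#|` Omega| <= N)%N,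
        forall x, ell2 x -> spaceC (psi x) &
        A = psi \o galerkin alpha Omega]].

Definition recovery_error (R : realType) (alpha : R) (s : \bar R) (mu : R)
    (p : \bar R) (delta : R) (A : (R -> R) -> (R -> R)) : \bar R :=
  ereal_sup [set ereal_sup
      [set normC (fun t => crep alpha f t
                           - A fdelta t * Num.sqrt (weight alpha t))
      | fdelta in [set g | L2w alpha g /\
          (lnorm p (fun k => coef alpha g k - coef alpha f k)%R <= delta%:E)%E]]
  | f in Wclass alpha s mu].

Definition galerkin_radius (R : realType) (alpha : R) (s : \bar R) (mu : R)
    (p : \bar R) (N : nat) (delta : R) : \bar R :=
  ereal_inf [set recovery_error alpha s mu p delta A | A in Psi alpha N].

Definition inf_galerkin_radius (R : realType) (alpha : R) (s : \bar R) (mu : R)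
    (p : \bar R) (delta : R) : \bar R :=
  ereal_inf [set galerkin_radius alpha s mu p N delta | N in [set N | (1 <= N)%N]].

(* 1 / p, with 1 / +oo = 0 (not intended for p = -oo). *)
Definition recip (R : realType) (p : \bar R) : R :=
  if p is q%:E then q^-1 else 0.

(* A(delta) and B(delta) are within constant factors of each other, uniformly
   for 0 < delta < 1. *)
Definition asymp (R : realType) (A B : R -> \bar R) : Prop :=
  exists c1 c2 : R, [/\ 0 < c1, 0 < c2 &
    forall delta : R, 0 < delta < 1 ->
      (A delta <= c1%:E * B delta)%E /\ (B delta <= c2%:E * A delta)%E].

(* Main.v *)
Require Import Defs.
From mathcomp Require Import all_boot all_order all_algebra finmap.
From mathcomp Require Import all_classical all_reals all_analysis.
From mathcomp Require Import measurable_realfun ess_sup_inf ring lra.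

(** Write [phi_k] for the normalized Laguerre functions
    [nlaguerre alpha k * sqrt w] and [gam = mu + 1/s - 1 > 0].  Two facts about
    them drive everything.

    (a) [phi_k] is bounded uniformly in [k] and [t] for each [alpha >= 0].
    Close to the origin the power series is dominated by its constant term.  In
    the oscillatory region [t <= nu/2], [nu = 4k + 2 alpha + 2], the energy
    [phi^2 + (t phi')^2 / q] with [q = (nu t - t^2 - alpha^2) / 4] is
    nonincreasing (Sonin).  Beyond it, the L2 norms of [L_k] and of
    [sqrt t L_k'] bound the variation of [phi_k^2] on [(t, oo)], because
    [int w t L_k'^2 = k int w L_k^2].

    (b) [phi_k(t) >= c > 0] for all [M <= k <= 4M] at the single point
    [t = 1/(16M)], so sums of consecutive [phi_k] do not cancel there.

    By (a), truncation to [k < N] has error [O(N^-gam + N^(1-1/p) delta)].  By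
    (b), a constant multiple of the sum of [phi_k] over about [M] indices near
    [M] belongs to the class and has sup norm of order [M^-gam].  If the indices
    avoid [Omega], it is invisible to the information, whence [R >= c N^-gam]; if
    [M] is of order [delta^(-1/(mu-1/p+1/s))], the noise can hide it, whence
    [R >= c delta^(gam/(mu-1/p+1/s))] for every [N]. *)

Set Implicit Arguments.
Unset Strict Implicit.
Unset Printing Implicit Defensive.

Import Order.TTheory GRing.Theory Num.Theory.
Import numFieldNormedType.Exports.

Local Open Scope classical_set_scope.
Local Open Scope ring_scope.

(** * The Gamma function *)

Lemma halflineE (R : realType) (t : R) : halfline t = (0 < t) :> Prop.
Proof. by rewrite /halfline/= in_itv/= andbT. Qed.

Lemma measurable_halfline (R : realType) :
  measurable (halfline : set (measurableTypeR R)).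
Proof. exact: measurable_itv. Qed.

(** The power is at most [1 + t ^+ n] for an integer [n] above [a], and [t ^+ n] is controlled by
    one term of the exponential series at [t / 2]. Half of the decay of [expR (- t)] is left over
    for integrability and for the limit at infinity. *)
Lemma powR_le_expR (R : realType) (a : R) : 0 <= a ->
  exists2 C : R, 0 < C & forall t, 0 < t -> t `^ a <= C * expR (t / 2).
Proof.
move=> a0; set n := (Num.truncn a).+1.
have an : a <= n%:R by apply/ltW/truncnS_gt.
exists (1 + 2 ^+ n * n`!%:R) => [|t t0].
  by rewrite ltr_pwDl// mulr_ge0// exprn_ge0.
have e1 : 1 <= expR (t / 2) by rewrite -[leLHS]expR0 ler_expR divr_ge0// ltW.
have tn : t `^ a <= 1 + t ^+ n.
  have [t1|t1] := leP t 1.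
    rewrite (@le_trans _ _ 1)//; last by rewrite lerDl exprn_ge0// ltW.
    by rewrite -(powRr0 t) ger_powR// t0.
  rewrite (@le_trans _ _ (t ^+ n))//; last by rewrite lerDr.
  by rewrite -powR_mulrn ?(ltW t0)// ler_powR// ltW.
apply: (le_trans tn); rewrite mulrDl mul1r lerD//.
have : (t / 2) ^+ n / n`!%:R <= expR (t / 2).
  by apply: le_trans (@expR_ge1Dxn R (t/2) n.-1 _); [rewrite lerDr|lra].
rewrite expr_div_n ler_pdivrMr ?ltr0n ?fact_gt0// ler_pdivrMr ?exprn_gt0//.
by rewrite (mulrC (expR _)) mulrAC -mulrA mulrCA mulrA mulrC.
Qed.

Lemma is_derive_expRc (R : realType) (c t : R) :
  is_derive t 1 (fun x => expR (c * x)) (c * expR (c * t)).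
Proof.
have Hc : is_derive t 1 ( *%R c) c.
  have := @is_deriveZ R R R (id : R -> R) c t 1 1 _.
  by rewrite [_ *: 1]mulr1; apply.
by rewrite mulrC; apply: (@is_derive1_comp R expR ( *%R c)).
Qed.

Lemma integrable_expR2 (R : realType) :
  lebesgue_measure.-integrable halfline (fun t : R => (expR (- t / 2))%:E).
Proof.
have de (t : R) : is_derive t 1 (fun x => expR (- x / 2)) (- 2^-1 * expR (- t / 2)).
  rewrite (_ : (fun x : R => expR (- x / 2)) = (fun x => expR (- 2^-1 * x))).
    have -> : - t / 2 = - 2^-1 * t by lra.
    exact: is_derive_expRc.
  by apply/funext => x; congr expR; lra.
have ce : continuous (fun x : R => expR (- x / 2)).
  by move=> x; apply/differentiable_continuous/derivable1_diffP; apply: ex_derive.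
apply/integrableP; split.
  apply/measurable_EFinP; apply: measurable_funTS.
  exact: continuous_measurable_fun.
under eq_integral do rewrite /= ger0_norm ?expR_ge0//.
rewrite /halfline integral_itv_obnd_cbnd; last first.
  apply/measurable_EFinP; apply: measurable_funTS.
  exact: continuous_measurable_fun.
rewrite (@ge0_continuous_FTC2y R _ (fun x => - 2 * expR (- x / 2)) 0 0).
- by rewrite oppr0 mul0r expR0 ltry.
- by move=> x _; exact: expR_ge0.
- exact: continuous_subspaceT.
- rewrite -(mulr0 (- 2 : R)); apply: cvgM; first exact: cvg_cst.
  have h : (fun x : R => expR (- (x / 2))) x @[x --> +oo] --> (0 : R).
    apply: (@cvg_comp _ _ _ (fun x : R => x / 2) (fun x => expR (- x)) _ (pinfty_nbhs R)).
      by apply: gt0_cvgMly => //.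
    exact: cvgr_expR.
  by under eq_fun do rewrite mulNr.
- by move=> x _; apply: ex_derive.
- by apply: cvg_at_right_filter; apply: cvgM; [exact: cvg_cst|exact: ce].
- move=> x _; rewrite derive1E.
  have [_ ->] := @is_deriveM R R (cst (- 2)) _ x 1 _ _ _ (de x).
  rewrite /GRing.scale/=; lra.
Qed.

Lemma integrable_halflineB (R : realType) (f g : R -> R) :
  lebesgue_measure.-integrable halfline (EFin \o f) ->
  lebesgue_measure.-integrable halfline (EFin \o g) ->
  lebesgue_measure.-integrable halfline (fun t => (f t - g t)%:E).
Proof.
move=> intf intg.
exact: (integrableB (@measurable_halfline R) intf intg).
Qed.

Lemma continuous_expRN (R : realType) : continuous (fun t : R => expR (- t)).
Proof.
by move=> x; apply/differentiable_continuous/derivable1_diffP; apply: ex_derive.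
Qed.

Lemma continuous_powR_expR (R : realType) (a x : R) : 0 < x ->
  {for x, continuous (fun t => t `^ a * expR (- t))}.
Proof.
move=> x0; apply: (@continuousM R R (fun t => t `^ a) (fun t => expR (- t))).
  apply/differentiable_continuous/derivable1_diffP.
  by apply: ex_derive; exact: is_derive1_powR.
exact: continuous_expRN.
Qed.

Lemma measurable_powR_expR (R : realType) (a : R) (D : set R) :
  measurable_fun D (fun t => t `^ a * expR (- t)).
Proof.
apply: measurable_funTS; apply: measurable_funM.
  exact: measurable_powR.
by apply: continuous_measurable_fun; exact: continuous_expRN.
Qed.

Lemma integrable_powR_expR (R : realType) (a : R) : 0 <= a ->
  lebesgue_measure.-integrable halfline (fun t => (t `^ a * expR (- t))%:E).
Proof.
move=> /powR_le_expR [C C0 hC].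
apply: (@le_integrable _ _ R lebesgue_measure _ (@measurable_halfline R) _
  (fun t => (C * expR (- t / 2))%:E)).
- by apply/measurable_EFinP; exact: measurable_powR_expR.
- move=> t; rewrite halflineE => t0.
  rewrite /= lee_fin !ger0_norm ?mulr_ge0 ?expR_ge0 ?powR_ge0// ?(ltW C0)//.
  have -> : expR (- t / 2) = expR (t / 2) * expR (- t).
    by rewrite -expRD; congr expR; lra.
  by rewrite mulrA ler_wpM2r ?expR_ge0// hC.
- under eq_fun do rewrite EFinM.
  apply: integrableZl; first exact: measurable_halfline.
  exact: integrable_expR2.
Qed.

Lemma powR_expR_cvg0 (R : realType) (a : R) : 0 <= a ->
  (fun t => t `^ a * expR (- t)) t @[t --> +oo] --> (0 : R).
Proof.
move=> /powR_le_expR [C C0 hC].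
apply: (@squeeze_cvgr _ _ _ _ (cst 0) (fun t => C * expR (- (t / 2)))).
- near=> t; have t0 : 0 < t by near: t; exact: nbhs_pinfty_gt.
  rewrite mulr_ge0 ?expR_ge0 ?powR_ge0//=.
  have -> : expR (- (t / 2)) = expR (t / 2) * expR (- t).
    by rewrite -expRD; congr expR; lra.
  by rewrite mulrA ler_wpM2r ?expR_ge0// hC.
- exact: cvg_cst.
- rewrite -[X in _ --> X](mulr0 C); apply: cvgM; first exact: cvg_cst.
  apply: (@cvg_comp _ _ _ (fun x : R => x / 2) (fun x => expR (- x)) _ (pinfty_nbhs R)).
    by apply: gt0_cvgMly => //.
  exact: cvgr_expR.
Unshelve. end_near. Qed.

(** The power with base 0 is 1 for [a = 0] and 0 for [a > 0], which is the right limit in both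
    cases. *)
Lemma powR_expR_cvg_at_right0 (R : realType) (a : R) : 0 <= a ->
  (fun t => t `^ a * expR (- t)) t @[t --> 0^'+] --> 0 `^ a * expR (- (0 : R)).
Proof.
move=> a0; apply: cvgM; last first.
  apply: cvg_at_right_filter; exact: (@continuous_expRN R 0).
have [->|a0'] := eqVneq a 0.
  under eq_fun do rewrite powRr0.
  by rewrite powRr0; exact: cvg_cst.
by rewrite powR0//; apply: powR_cvg0; rewrite lt_neqAle eq_sym a0'.
Qed.

Lemma is_derive_powR_expR (R : realType) (a x : R) : 0 < x ->
  is_derive x 1 (fun t => t `^ a * expR (- t))
   (a * (x `^ (a - 1) * expR (- x)) - x `^ a * expR (- x)).
Proof.
move=> x0; have h1 := is_derive1_powR a x0.
have h2 : is_derive x 1 (fun t : R => expR (- t)) (- expR (- x)).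
  have := @is_derive_expRc R (-1) x; rewrite !mulN1r.
  by under eq_fun do rewrite mulN1r.
have := @is_deriveM _ _ _ _ x 1 _ _ h1 h2.
by rewrite /GRing.scale/=; set u := _ + _; set v := _ - _; have -> : u = v
  by rewrite /u /v; ring.
Qed.

(** Integration by parts: [f] is the derivative of [F], which vanishes at 0 and at infinity, so [f]
    integrates to 0. The half-line is cut at [x] because [f] carries the factor [x - t]: it is
    nonpositive beyond [x], which the improper fundamental theorem asks for, and the rest is a
    compact interval. *)
Lemma GammaS (R : realType) (x : R) : 1 <= x -> Gamma (x + 1) = x * Gamma x.
Proof.
move=> x1; have x0 : 0 < x by lra.
pose f t := x * (t `^ (x - 1) * expR (- t)) - t `^ x * expR (- t).
pose F (t : R) := t `^ x * expR (- t).
have intf1 : lebesgue_measure.-integrable halfline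
    (fun t : R => (t `^ (x - 1) * expR (- t))%:E).
  by apply: integrable_powR_expR; lra.
have intf2 : lebesgue_measure.-integrable halfline
    (fun t : R => (t `^ x * expR (- t))%:E).
  by apply: integrable_powR_expR; lra.
have fE (t : R) : 0 < t -> f t = (t `^ (x - 1) * expR (- t)) * (x - t).
  move=> t0; rewrite /f -[in t `^ x](mulr_powRB1 (ltW t0) x0); ring.
have cf : {in `]0, +oo[, continuous f}.
  move=> t; rewrite in_itv/= andbT => t0.
  apply: cvgB; last exact: continuous_powR_expR.
  by apply: cvgM; [exact: cvg_cst|exact: continuous_powR_expR].
have f0 : f t @[t --> 0^'+] --> f 0.
  apply: cvgB; last by apply: powR_expR_cvg_at_right0; lra.
  apply: cvgM; first exact: cvg_cst.
  by apply: powR_expR_cvg_at_right0; lra.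
have F'f : {in `]0, +oo[, F^`()%classic =1 f}.
  move=> t; rewrite in_itv/= andbT => t0; rewrite derive1E.
  by have [_ ->] := is_derive_powR_expR x t0.
have F0 : F 0 = 0 by rewrite /F powR0 ?mul0r// gt_eqF.
have Fl : F t @[t --> x^'-] --> F x.
  by apply: cvg_at_left_filter; exact: continuous_powR_expR.
have Fr : F t @[t --> x^'+] --> F x.
  by apply: cvg_at_right_filter; exact: continuous_powR_expR.
have I1 : (\int[lebesgue_measure]_(t in `[0%R, x]) (f t)%:E = (F x)%:E - (F 0)%:E)%E.
  apply: continuous_FTC2 => //.
  - apply/continuous_within_itvP => //; split => //.
    + by move=> t; rewrite in_itv/= => /andP[t0 _]; apply: cf; rewrite in_itv/= t0.
    + by apply: cvg_at_left_filter; apply: cf; rewrite in_itv/= x0.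
  - split=> //.
    + move=> t; rewrite in_itv/= => /andP[t0 _].
      by have [] := is_derive_powR_expR x t0.
    + by apply: powR_expR_cvg_at_right0; lra.
  - move=> t; rewrite in_itv/= => /andP[t0 _].
    by apply: F'f; rewrite in_itv/= t0.
have I2 : (\int[lebesgue_measure]_(t in `[x, +oo[) (f t)%:E = 0%:E - (F x)%:E)%E.
  apply: le0_continuous_FTC2y => //.
  - move=> t xt; have t0 : 0 < t by lra.
    rewrite fE//.
    by rewrite mulr_ge0_le0 ?mulr_ge0 ?powR_ge0 ?expR_ge0//; lra.
  - apply/continuous_within_itvcyP; split.
      by move=> t; rewrite in_itv/= andbT => xt; apply: cf; rewrite in_itv/= andbT; lra.
    by apply: cvg_at_right_filter; apply: cf; rewrite in_itv/= x0.
  - by apply: powR_expR_cvg0; lra.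
  - by move=> t /(lt_trans x0) t0; have [] := is_derive_powR_expR x t0.
  - move=> t; rewrite in_itv/= andbT => xt.
    by apply: F'f; rewrite in_itv/= andbT (lt_trans x0 xt).
have mf D : measurable_fun D (EFin \o f).
  apply/measurable_EFinP; apply: measurable_funB; last exact: measurable_powR_expR.
  by apply: measurable_funM => //; exact: measurable_powR_expR.
have intxf : lebesgue_measure.-integrable halfline
    (fun t : R => (x * (t `^ (x - 1) * expR (- t)))%:E).
  under eq_fun do rewrite EFinM.
  by apply: integrableZl => //; exact: measurable_halfline.
have intf : lebesgue_measure.-integrable halfline (EFin \o f).
  exact: integrable_halflineB.
have : \int[lebesgue_measure]_(t in halfline) f t = 0.
  have := @Rintegral_itvB R f (BRight 0) +oo%O x intf.
  rewrite !bnd_simp => /(_ (ltW x0) isT) /eqP; rewrite subr_eq => /eqP ->.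
  rewrite /Rintegral !integral_itv_obnd_cbnd// I1 I2 F0/=; lra.
rewrite /f RintegralB//; last exact: measurable_halfline.
rewrite RintegralZl//; last exact: measurable_halfline.
by rewrite /Gamma addrK => /eqP; rewrite subr_eq0 => /eqP.
Qed.

Lemma Gamma_ge0 (R : realType) (x : R) : 0 <= Gamma x.
Proof.
by apply: Rintegral_ge0 => t _; rewrite mulr_ge0 ?powR_ge0 ?expR_ge0.
Qed.

(** On [1, 2] the integrand is at least [expR (- 2)]. *)
Lemma Gamma_gt0 (R : realType) (x : R) : 1 <= x -> 0 < Gamma x.
Proof.
move=> x1.
have intf : lebesgue_measure.-integrable halfline
    (fun t : R => (t `^ (x - 1) * expR (- t))%:E).
  by apply: integrable_powR_expR; lra.
rewrite (@lt_le_trans _ _ (expR (- 2)))// ?expR_gt0//.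
have -> : expR (- 2) = \int[lebesgue_measure]_(t in `[(1 : R), 2]) expR (- 2).
  rewrite Rintegral_cst//= lebesgue_measure_itv/= lte_fin ltr1n -EFinB/=.
  by rewrite (_ : 2 - 1 = 1 :> R) ?mulr1//; lra.
have sub : `[(1 : R), 2] `<=` halfline.
  by move=> t; rewrite halflineE/= in_itv/= => /andP[t1 _]; lra.
have intI : lebesgue_measure.-integrable `[(1 : R), 2]
    (fun t : R => (t `^ (x - 1) * expR (- t))%:E).
  by apply: integrableS intf => //; exact: measurable_halfline.
apply: (@le_trans _ _ (\int[lebesgue_measure]_(t in `[(1 : R), 2])
   (t `^ (x - 1) * expR (- t)))).
  apply: le_Rintegral => //.
    apply: continuous_compact_integrable; first exact: segment_compact.
    by apply: continuous_subspaceT => ?; exact: cvg_cst.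
  move=> t; rewrite /= in_itv/= => /andP[t1 t2].
  rewrite -[leLHS]mul1r ler_pM ?expR_ge0// ?ler_expR ?lerN2//.
  by rewrite -[leLHS](powRr0 t) ler_powR// subr_ge0.
rewrite /Gamma/Rintegral fine_le ?integrable_fin_num//; first exact: measurable_itv.
apply: ge0_subset_integral => //.
- exact: measurable_halfline.
- by apply/measurable_EFinP; exact: measurable_powR_expR.
- by move=> t _; rewrite lee_fin mulr_ge0 ?powR_ge0 ?expR_ge0.
Qed.

(** * Growth of Gamma(n + a + 1) / n! *)

Lemma Gamma_ratioS (R : realType) (a : R) (n : nat) : 0 <= a ->
  Gamma (n.+1%:R + a + 1) / n.+1`!%:R =
  (1 + a / n.+1%:R) * (Gamma (n%:R + a + 1) / n`!%:R).
Proof.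
move=> a0; have n0 : 0 <= n%:R :> R by [].
rewrite -natr1 (_ : n%:R + 1 + a + 1 = (n%:R + a + 1) + 1); last by ring.
rewrite GammaS; last by lra.
rewrite factS natrM -natr1; field.
by rewrite pnatr_eq0 -lt0n fact_gt0/= natr1 pnatr_eq0.
Qed.


(** For n >= 1, 1 + a/(n+1) <= exp(a/(n+1)) <= ((n+1)/n)^a, and the product of the right-hand sides
    telescopes. *)
Lemma powR_growth_le (R : realType) (a : R) (g : nat -> R) : 0 <= a ->
  (forall n, 0 < g n) -> (forall n, g n.+1 = (1 + a / n.+1%:R) * g n) ->
  exists2 C : R, 0 < C & forall n, g n <= C * n.+1%:R `^ a.
Proof.
move=> a0 g_gt0 gS.
(* The index is shifted by one because the comparison factor ((n+1)/n)^a has no value at n = 0; the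
   bound on [g 0] comes at the end from [g 0 <= g 1]. *)
have gle n : g n.+1 <= g 1%N * n.+1%:R `^ a.
  elim: n => [|n IH]; first by rewrite powR1 mulr1.
  rewrite gS; have n2 : 0 < n.+2%:R :> R by [].
  have n1 : 0 < n.+1%:R :> R by [].
  have h1 : expR (n.+2%:R^-1) <= n.+2%:R / n.+1%:R :> R.
    rewrite -[leLHS]invrK -expRN invf_ple ?posrE ?expR_gt0 ?divr_gt0//.
    rewrite invf_div (le_trans _ (expR_ge1Dx _))//.
    rewrite -[n.+2%:R]natr1 ler_pdivrMr ?natr1// mulrBl mulVf ?gt_eqF// mul1r.
    by rewrite -[n.+2%:R]natr1 addrK.
  have h2 : 1 + a / n.+2%:R <= (n.+2%:R / n.+1%:R) `^ a.
    apply: (le_trans (expR_ge1Dx _)).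
    by rewrite mulrC expRM ge0_ler_powR ?nnegrE ?expR_ge0 ?divr_ge0.
  have -> : n.+2%:R `^ a = (n.+2%:R / n.+1%:R) `^ a * n.+1%:R `^ a :> R.
    have n1' : n.+1%:R != 0 :> R by rewrite gt_eqF.
    have q0 : 0 <= n.+2%:R / n.+1%:R :> R by rewrite ltW// divr_gt0.
    by rewrite -(powRM _ q0 (ltW n1)) (divfK n1').
  rewrite mulrCA; apply: ler_pM => //; last exact/ltW/g_gt0.
  by rewrite addr_ge0 ?divr_ge0.
exists (g 1%N) => // -[|n].
  rewrite powR1 mulr1 gS; rewrite ler_peMl ?(ltW (g_gt0 _))//.
  by rewrite lerDl divr_ge0.
apply: (le_trans (gle n)); rewrite ler_wpM2l ?(ltW (g_gt0 _))//.
by rewrite ge0_ler_powR ?nnegrE ?ler_nat.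
Qed.

(** Here the product telescopes against (n+1+a)^a. The shift by [a] is what gives
    ((n+2+a)/(n+1+a))^a <= exp(a/(n+1+a)) <= 1 + a/(n+1). *)
Lemma powR_growth_ge (R : realType) (a : R) (g : nat -> R) : 0 <= a ->
  (forall n, 0 < g n) -> (forall n, g n.+1 = (1 + a / n.+1%:R) * g n) ->
  exists2 c : R, 0 < c & forall n, c * n.+1%:R `^ a <= g n.
Proof.
move=> a0 g_gt0 gS.
have a1 : 0 < (1 + a) `^ a by rewrite powR_gt0; lra.
have gge n : g 0%N * (n.+1%:R + a) `^ a <= g n * (1 + a) `^ a.
  elim: n => [//|n IH]; rewrite gS.
  have m0 : 0 < n.+1%:R + a by rewrite ltr_pwDl.
  have n1 : 0 < n.+1%:R :> R by [].
  have h : ((n.+2%:R + a) / (n.+1%:R + a)) `^ a <= 1 + a / n.+1%:R.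
    have h1 : (n.+2%:R + a) / (n.+1%:R + a) <= expR (n.+1%:R + a)^-1.
      apply: le_trans (expR_ge1Dx _).
      rewrite -[n.+2%:R]natr1 addrAC mulrDl divff ?gt_eqF// mul1r//.
    have h2 : expR (a / (n.+1%:R + a)) <= 1 + a / n.+1%:R.
      rewrite -[leLHS]invrK -expRN invf_ple ?posrE ?expR_gt0//; last first.
        by rewrite ltr_pwDl// divr_ge0.
      apply: le_trans (expR_ge1Dx _).
      rewrite le_eqVlt; apply/orP; left; apply/eqP; field.
      by rewrite nat1r !gt_eqF.
    apply: le_trans h2; rewrite [X in expR X]mulrC expRM ge0_ler_powR ?nnegrE ?expR_ge0//.
    by rewrite divr_ge0 ?addr_ge0// ltW.
  have -> : (n.+2%:R + a) `^ a =
      ((n.+2%:R + a) / (n.+1%:R + a)) `^ a * (n.+1%:R + a) `^ a.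
    have q0 : 0 <= (n.+2%:R + a) / (n.+1%:R + a).
      by rewrite divr_ge0 ?(ltW m0)// addr_ge0.
    by rewrite -(powRM _ q0 (ltW m0)) divfK// gt_eqF.
  rewrite mulrCA -mulrA ler_pM ?powR_ge0//.
  by rewrite mulr_ge0 ?powR_ge0// ltW.
exists (g 0%N / (1 + a) `^ a) => [|n]; first by rewrite divr_gt0.
rewrite mulrAC ler_pdivrMr// (le_trans _ (gge n))// ler_wpM2l ?(ltW (g_gt0 _))//.
by rewrite ge0_ler_powR ?nnegrE ?addr_ge0// lerDl.
Qed.

Lemma Gamma_ratio_le (R : realType) (a : R) : 0 <= a -> exists2 C : R, 0 < C &
  forall n, Gamma (n%:R + a + 1) / n`!%:R <= C * n.+1%:R `^ a.
Proof.
move=> a0; apply: (@powR_growth_le _ a (fun n => Gamma (n%:R + a + 1) / n`!%:R)) => // n.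
  rewrite divr_gt0 ?ltr0n ?fact_gt0// Gamma_gt0//.
  by rewrite lerDr addr_ge0.
exact: Gamma_ratioS.
Qed.

Lemma Gamma_ratio_ge (R : realType) (a : R) : 0 <= a -> exists2 c : R, 0 < c &
  forall n, c * n.+1%:R `^ a <= Gamma (n%:R + a + 1) / n`!%:R.
Proof.
move=> a0; apply: (@powR_growth_ge _ a (fun n => Gamma (n%:R + a + 1) / n`!%:R)) => // n.
  rewrite divr_gt0 ?ltr0n ?fact_gt0// Gamma_gt0//.
  by rewrite lerDr addr_ge0.
exact: Gamma_ratioS.
Qed.

(** * Laguerre polynomials *)

Lemma poly_XnZ_ind (R : nzRingType) (P : {poly R} -> Prop) :
  (forall p q, P p -> P q -> P (p + q)) -> (forall c n, P (c *: 'X^n)) ->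
  forall p, P p.
Proof.
move=> PD PZ p; rewrite -[p]coefK poly_def.
elim/big_ind : _ => //; by rewrite -(scale0r 'X^0).
Qed.

(** As a linear functional on [{poly R}], integration against the weight lets orthogonality and
    integration by parts be proved by polynomial algebra. *)
Definition mom (R : realType) (a : R) (p : {poly R}) : R :=
  \int[lebesgue_measure]_(t in halfline) (weight a t * p.[t]).

Section moments.
Context {R : realType}.
Implicit Types (a : R) (p q : {poly R}).

Lemma weight_ge0 a t : 0 <= weight a t.
Proof. by rewrite mulr_ge0 ?powR_ge0 ?expR_ge0. Qed.

Lemma weightMXn a n t : 0 < t -> weight a t * t ^+ n = t `^ (n%:R + a) * expR (- t).
Proof.
move=> t0; rewrite /weight powRD; last by rewrite (gt_eqF t0) implybT.
by rewrite powR_mulrn ?(ltW t0)//; ring.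
Qed.

Lemma integrable_weightM a p : 0 <= a ->
  lebesgue_measure.-integrable halfline (fun t => (weight a t * p.[t])%:E).
Proof.
move=> a0; elim/poly_XnZ_ind : p => [p q hp hq|c n].
  apply: (eq_integrable (@measurable_halfline R) _ _ _
    (integrableD (@measurable_halfline R) hp hq)) => t _.
  by rewrite -EFinD hornerD mulrDr.
have h : lebesgue_measure.-integrable halfline
    (fun t => (t `^ (n%:R + a) * expR (- t))%:E).
  by apply: integrable_powR_expR; rewrite addr_ge0.
apply: (eq_integrable (@measurable_halfline R) _ _ _
  (integrableZl (@measurable_halfline R) c h)) => t.
rewrite inE halflineE => t0.
by rewrite hornerZ hornerXn mulrCA weightMXn.
Qed.

Lemma momD a p q : 0 <= a -> mom a (p + q) = mom a p + mom a q.
Proof.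
move=> a0; rewrite /mom -RintegralD//; last first.
  exact: integrable_weightM.
  exact: integrable_weightM.
  exact: measurable_halfline.
by apply: eq_Rintegral => t _; rewrite hornerD mulrDr.
Qed.

Lemma momZ a c p : 0 <= a -> mom a (c *: p) = c * mom a p.
Proof.
move=> a0; rewrite /mom -RintegralZl//; last first.
  exact: integrable_weightM.
  exact: measurable_halfline.
by apply: eq_Rintegral => t _; rewrite hornerZ mulrCA.
Qed.

Lemma momN a p : 0 <= a -> mom a (- p) = - mom a p.
Proof. by move=> a0; rewrite -scaleN1r momZ// mulN1r. Qed.

Lemma mom0 a : 0 <= a -> mom a 0 = 0.
Proof. by move=> a0; rewrite -(scale0r 0) momZ// mul0r. Qed.

Lemma momXn a n : 0 <= a -> mom a 'X^n = Gamma (n%:R + a + 1).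
Proof.
move=> a0; rewrite /mom /Gamma; apply: eq_Rintegral => t.
by rewrite inE halflineE => t0; rewrite hornerXn weightMXn// addrK.
Qed.

Lemma momMX a p : mom a ('X * p) = mom (a + 1) p.
Proof.
apply: eq_Rintegral => t; rewrite inE halflineE => t0.
rewrite hornerM hornerX mulrA; congr (_ * _).
by rewrite -[X in _ * X]expr1 weightMXn// addrC.
Qed.

Lemma mom_sum (I : Type) (s : seq I) (P : pred I) (F : I -> {poly R}) a :
  0 <= a -> mom a (\sum_(i <- s | P i) F i) = \sum_(i <- s | P i) mom a (F i).
Proof.
by move=> a0; apply: big_morph => [p q|]; [exact: momD|exact: mom0].
Qed.

(** The derivative of t^(a+1) e^(-t) p(t) has integral 0. By linearity only monomials need checking,
    and there the claim is the functional equation of [Gamma]. *)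
Lemma mom_parts a p : 0 <= a ->
  mom a ('X * p^`()) + (a + 1) * mom a p = mom a ('X * p).
Proof.
move=> a0; elim/poly_XnZ_ind : p => [p q hp hq|c n].
  by rewrite derivD !mulrDr !momD// -hp -hq; ring.
rewrite derivZ derivXn -!scalerAr !momZ// -exprS momXn// momXn//.
have -> : mom a ('X * ('X^(n.-1) *+ n)) = n%:R * Gamma (n%:R + a + 1).
  case: n => [|n]; first by rewrite mulr0n mulr0 mom0// mul0r.
  by rewrite mulrnAr -exprS -scaler_nat momZ// momXn.
rewrite -natr1 (_ : n%:R + 1 + a + 1 = (n%:R + a + 1) + 1); last by ring.
by rewrite (@GammaS R (n%:R + a + 1)); [ring|rewrite lerDr addr_ge0].
Qed.

End moments.

(** * Differential equation, orthogonality and norms *)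

Definition lagpoly (R : realType) (a : R) (k : nat) : {poly R} :=
  \poly_(m < k.+1) (Gamma (k%:R + a + 1) / (Gamma (m%:R + a + 1) * (k - m)`!%:R)
     * ((-1) ^+ m / m`!%:R)).

Section laguerre_polynomials.
Context {R : realType}.
Implicit Types (a : R) (k n m : nat).

Lemma laguerreE a k t : laguerre a k t = (lagpoly a k).[t].
Proof.
rewrite horner_poly; apply: eq_bigr => m _.
by rewrite (exprNn t); ring.
Qed.

Let Gamma_neq0 a m : 0 <= a -> Gamma (m%:R + a + 1) != 0.
Proof. by move=> a0; rewrite gt_eqF// Gamma_gt0// lerDr addr_ge0. Qed.

Let fact_neq0 m : m`!%:R != 0 :> R.
Proof. by rewrite pnatr_eq0 -lt0n fact_gt0. Qed.

Lemma lagpoly0 a : 0 <= a -> lagpoly a 0 = 1.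
Proof.
move=> a0; apply/polyP => i; rewrite coef_poly coef1.
case: i => [|i]//=; rewrite fact0 expr0 !mulr1 divr1.
by rewrite mulr1 divff// Gamma_neq0.
Qed.

(** This is the Laguerre differential equation read off coefficient by coefficient. It holds for
    every [m]: at [m = k] the factor on the right vanishes, and above the degree both coefficients
    do. *)
Lemma coef_lagpolyS a k m : 0 <= a ->
  m.+1%:R * (m%:R + a + 1) * (lagpoly a k)`_m.+1 = (m%:R - k%:R) * (lagpoly a k)`_m.
Proof.
move=> a0; rewrite !coef_poly ltnS.
have [mk|km|->] := ltngtP m k.
- rewrite ltnS (ltnW mk).
  rewrite -[m.+1%:R]natr1 (_ : m%:R + 1 + a + 1 = (m%:R + a + 1) + 1); last by ring.
  rewrite (@GammaS R (m%:R + a + 1)); last by rewrite lerDr addr_ge0.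
  rewrite -(subnSK mk) factS factS !natrM exprS -natr1.
  have -> : (k - m.+1).+1%:R = k%:R - m%:R :> R by rewrite subnSK// natrB// ltnW.
  have h1 : k%:R - m%:R != 0 :> R by rewrite gt_eqF// subr_gt0 ltr_nat.
  have h2 : m%:R + 1 != 0 :> R by rewrite natr1 pnatr_eq0.
  have h3 : m%:R + a + 1 != 0 by rewrite gt_eqF// ltr_wpDl// addr_ge0.
  move: (Gamma_neq0 (a := a) m a0) h1 h2 h3 (fact_neq0 m) (fact_neq0 (k - m.+1)).
  move: m`!%:R (k - m.+1)`!%:R ((-1) ^+ m) k%:R m%:R.
  move=> u v e k' m' y0 h1 h2 h3 u0 v0.
  by field; rewrite y0 h1 h2 h3 u0 v0.
- by rewrite ltnS leqNgt km !mulr0.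
- by rewrite mulr0 subrr mul0r.
Qed.

Lemma deriv_lagpoly a k : 0 <= a -> (lagpoly a k.+1)^`() = - lagpoly (a + 1) k.
Proof.
move=> a0; apply/polyP => m; rewrite coef_deriv coefN !coef_poly ltnS.
case: ifP => mk; last by rewrite mul0rn oppr0.
rewrite subSS exprS factS natrM -[_ *+ m.+1]mulr_natr.
have E (j : nat) : j.+1%:R + a + 1 = j%:R + (a + 1) + 1 by rewrite -natr1; ring.
rewrite !E; move: (Gamma_neq0 (a := a + 1) m (addr_ge0 a0 ler01)).
move: (Gamma (m%:R + _ + 1)) (Gamma (k%:R + _ + 1)) => x y x0.
have m1 : m.+1%:R != 0 :> R by rewrite pnatr_eq0.
move: m.+1%:R m1 (fact_neq0 m) (fact_neq0 (k - m)) => z z0.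
move: m`!%:R (k - m)`!%:R ((-1) ^+ m) => u v e u0 v0.
by field; rewrite x0 z0 u0 v0.
Qed.

Lemma lagpoly_ode a k : 0 <= a ->
  'X * (lagpoly a k)^`()^`() + ((a + 1) *: (lagpoly a k)^`() - 'X * (lagpoly a k)^`())
  = - k%:R *: lagpoly a k.
Proof.
move=> a0; apply/polyP => m.
rewrite !(coefD, coefN, coefZ) !coefXM.
have := coef_lagpolyS k m a0.
case: m => [|m] /=; rewrite !coef_deriv => h.
  by move: h; rewrite !mulr0n !add0r subr0 mul1r mulr1n.
move: (lagpoly a k)`_m.+2 (lagpoly a k)`_m.+1 h => x y.
rewrite -(mulr_natr x) -(mulr_natr (x * _)) -(mulr_natr y).
move: m.+2%:R m.+1%:R k%:R => m2 m1 k' /eqP; rewrite -subr_eq0 => /eqP h.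
by apply/eqP; rewrite -subr_eq0 -[X in _ == X]h; apply/eqP; ring.
Qed.

(** The weak form of the differential equation: multiply it by [q] and integrate by parts. With [q]
    another Laguerre polynomial the right side is symmetric, which gives orthogonality; with [q] the
    same polynomial it gives the weighted norm of the derivative. *)
Lemma mom_lagpoly_deriv a k q : 0 <= a ->
  k%:R * mom a (q * lagpoly a k) = mom a ('X * (q^`() * (lagpoly a k)^`())).
Proof.
move=> a0; have := mom_parts (q * (lagpoly a k)^`()) a0.
have := lagpoly_ode k a0; set L := lagpoly a k => ode.
have -> : k%:R * mom a (q * L) = - mom a (q * (- k%:R *: L)).
  by rewrite -scalerAr momZ//; ring.
rewrite -ode !mulrDr !mulrN -!scalerAr !momD// momN// momZ//.
rewrite derivM mulrDr momD//.
rewrite !(mulrCA q 'X) => h.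
by rewrite -[mom a ('X * (q * L^`()))]h; ring.
Qed.

(** Both [k] times and [j] times this moment equal the same symmetric form in the two
    derivatives. *)
Lemma mom_lagpoly_orth a j k : 0 <= a -> j != k ->
  mom a (lagpoly a j * lagpoly a k) = 0.
Proof.
move=> a0 jk.
have h1 := mom_lagpoly_deriv k (lagpoly a j) a0.
have h2 := mom_lagpoly_deriv j (lagpoly a k) a0.
have : (k%:R - j%:R) * mom a (lagpoly a j * lagpoly a k) = 0.
  rewrite mulrBl h1 (mulrC (lagpoly a j)) h2.
  by rewrite [(lagpoly a k)^`() * _]mulrC subrr.
by move/eqP; rewrite mulf_eq0 subr_eq0 eqr_nat eq_sym (negbTE jk) => /eqP.
Qed.

(** Induction on the degree with [a] varying: differentiation lowers the degree and raises the
    parameter by one, and the factor ['X] of the weak form raises the parameter of the weight to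
    match. *)
Lemma mom_lagpoly_sqr a k : 0 <= a ->
  mom a (lagpoly a k * lagpoly a k) = Gamma (k%:R + a + 1) / k`!%:R.
Proof.
elim: k a => [|k IH] a a0.
  by rewrite lagpoly0// mulr1 -(expr0 'X) momXn// fact0 divr1.
have := mom_lagpoly_deriv k.+1 (lagpoly a k.+1) a0.
rewrite deriv_lagpoly// mulrNN momMX IH ?addr_ge0//.
have -> : k%:R + (a + 1) + 1 = k.+1%:R + a + 1 by rewrite -natr1; ring.
move=> h; have k1 : k.+1%:R != 0 :> R by rewrite pnatr_eq0.
by apply: (mulfI k1); rewrite h factS natrM; field; rewrite ?nat1r ?natr1 ?k1 ?fact_neq0.
Qed.

End laguerre_polynomials.

(** * Pointwise bounds *)

Section laguerre_bounds.
Context {R : realType}.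
Implicit Types (a t x : R) (p : {poly R}) (n m : nat).

Lemma is_derive_weight_poly a p t : 0 < t ->
  is_derive t 1 (fun x => weight a x * p.[x])
    (weight a t * ((a / t - 1) * p.[t] + p^`().[t])).
Proof.
move=> t0; have h1 := is_derive_powR_expR a t0.
have h2 := @is_derive_poly R p t.
have := @is_deriveM _ _ _ _ t 1 _ _ h1 h2.
rewrite /GRing.scale/= /weight; set u := _ + _; set v := _ * (_ + _).
suff -> : u = v by [].
have E : t `^ (a - 1) = t `^ a / t.
  by rewrite powRB ?powRr1 ?(ltW t0)// (gt_eqF t0) implybT.
by rewrite /u /v E; field; rewrite gt_eqF.
Qed.

Lemma weight_poly_cvg0 a p : 0 <= a ->
  (fun t => weight a t * p.[t]) t @[t --> +oo] --> (0 : R).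
Proof.
move=> a0; elim/poly_XnZ_ind : p => [p q hp hq|c n].
  rewrite (_ : (fun t => _) = (fun t => weight a t * p.[t] + weight a t * q.[t])).
    by rewrite -[X in _ --> X]addr0; exact: cvgD.
  by apply/funext => t; rewrite hornerD mulrDr.
have h : (fun t => t `^ (n%:R + a) * expR (- t)) t @[t --> +oo] --> (0 : R).
  by apply: powR_expR_cvg0; rewrite addr_ge0.
apply: (@cvg_trans _ ((fun t => c * (t `^ (n%:R + a) * expR (- t))) t @[t --> +oo])).
  apply: near_eq_cvg; near=> t.
  have t0 : 0 < t by near: t; exact: nbhs_pinfty_gt.
  by rewrite hornerZ hornerXn -weightMXn// mulrCA.
rewrite -(mulr0 c); apply: cvgM => //; exact: cvg_cst.
Unshelve. all: by end_near. Qed.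

(* Integrate [- (w L^2)' <= w (2 L^2 + t L'^2 / x)] over [[x, M]], where [M] is so
   large that [w(M) L(M)^2 <= h], the squared norm of [L]. *)
Lemma lagpoly_sqr_le_far a n x : 0 <= a -> 0 < x ->
  weight a x * (lagpoly a n).[x] ^+ 2 <=
    (3 + n%:R / x) * (Gamma (n%:R + a + 1) / n`!%:R).
Proof.
move=> a0 x0; set L := lagpoly a n; set h := _ / n`!%:R.
have h0 : 0 < h.
  by rewrite divr_gt0 ?ltr0n ?fact_gt0// Gamma_gt0// lerDr addr_ge0.
pose p := L * L; pose P := 2 *: p + x^-1 *: ('X * (L^`() * L^`())).
have momP : mom a P = (2 + n%:R / x) * h.
  rewrite /P momD// !momZ// -mom_lagpoly_deriv// mom_lagpoly_sqr//.
  by rewrite -/h; ring.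
pose f t := weight a t * ((a / t - 1) * p.[t] + p^`().[t]).
pose F t := weight a t * p.[t].
have [M xM FM] : exists2 M, x < M & F M <= h.
  have /cvgrPdist_le/(_ _ h0) H := weight_poly_cvg0 p a0.
  have [M /andP[xM HM]] : exists M, (x < M) && (`|0 - F M| <= h).
    near (pinfty_nbhs R) => M; exists M; apply/andP; split; near: M => //.
    by apply: nbhs_pinfty_gt; exact: num_real.
  exists M => //; apply: le_trans HM; rewrite sub0r normrN; exact: ler_norm.
have cw t : 0 < t -> {for t, continuous (weight a)} by exact: continuous_powR_expR.
have cf t : 0 < t -> {for t, continuous f}.
  move=> t0; apply: cvgM; first exact: cw.
  apply: cvgD; last exact: continuous_horner.
  apply: cvgM; last exact: continuous_horner.
  apply: cvgB; last exact: cvg_cst.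
  by apply: cvgM; [exact: cvg_cst|apply: cvgV; [rewrite gt_eqF|exact: cvg_id]].
have dF t : 0 < t -> is_derive t 1 F (f t) by exact: is_derive_weight_poly.
have cF t : 0 < t -> {for t, continuous F}.
  move=> t0; apply/differentiable_continuous/derivable1_diffP.
  by apply: ex_derive; exact: dF.
have M0 : 0 < M by apply: lt_trans xM.
have I : (\int[lebesgue_measure]_(t in `[x, M]) (f t)%:E = (F M)%:E - (F x)%:E)%E.
  apply: continuous_FTC2 => //.
  - apply/continuous_within_itvP => //; split.
    + by move=> t; rewrite in_itv/= => /andP[/(lt_trans x0) t0 _]; exact: cf.
    + by apply: cvg_at_right_filter; exact: cf.
    + by apply: cvg_at_left_filter; exact: cf.
  - split.
    + by move=> t; rewrite in_itv/= => /andP[/(lt_trans x0) /dF[]].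
    + by apply: cvg_at_right_filter; exact: cF.
    + by apply: cvg_at_left_filter; exact: cF.
  - move=> t; rewrite in_itv/= => /andP[/(lt_trans x0) t0 _].
    by rewrite derive1E; have [_ ->] := dF t t0.
have sub : `[x, M] `<=` halfline.
  by move=> t; rewrite halflineE/= in_itv/= => /andP[/(lt_le_trans x0)].
have IP : (\int[lebesgue_measure]_(t in `[x, M]) (weight a t * P.[t])%:E <=
    (mom a P)%:E)%E.
  rewrite /mom /Rintegral fineK; last first.
    by apply: integrable_fin_num; [exact: measurable_halfline|exact: integrable_weightM].
  apply: ge0_subset_integral => //.
  - exact: measurable_halfline.
  - by case/integrableP : (@integrable_weightM R a P a0).
  - move=> t; rewrite halflineE => t0; rewrite lee_fin mulr_ge0 ?weight_ge0//.
    rewrite /P /p hornerD !hornerZ !hornerM hornerX -!expr2.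
    apply: addr_ge0; first by rewrite mulr_ge0 ?sqr_ge0.
    by rewrite mulr_ge0 ?invr_ge0 ?(ltW x0)// mulr_ge0 ?sqr_ge0// ltW.
(* Up to the nonnegative term with [a / t], this is 2 L L' >= - (L^2 + L'^2) together with L'^2 <= t
   L'^2 / x for t >= x. *)
have fP (t : R) : x <= t -> -1 * (weight a t * P.[t]) <= f t.
  move=> xt; have t0 := lt_le_trans x0 xt.
  rewrite mulrCA ler_wpM2l ?weight_ge0// /P /p derivM.
  rewrite !hornerD !hornerZ !hornerM hornerX.
  set u := L.[t]; set v := L^`().[t].
  have h1 : 0 <= a / t * (u * u) by rewrite mulr_ge0 ?divr_ge0 ?(ltW t0)// -expr2 sqr_ge0.
  have h2 : v * v <= x^-1 * (t * (v * v)).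
    by rewrite mulrA ler_peMl -?expr2 ?sqr_ge0// mulrC ler_pdivlMr// mul1r.
  have h3 : 0 <= (u + v) * (u + v) by rewrite -expr2 sqr_ge0.
  move: h1 h2 h3; clearbody u v; clear; move: (a / t) x^-1 => b y.
  by move=> h1 h2 h3; lra.
have mI : measurable (`[x, M]%classic : set (measurableTypeR R)) by exact: measurable_itv.
have intP : lebesgue_measure.-integrable `[x, M] (fun t => (weight a t * P.[t])%:E).
  apply: (integrableS _ mI sub); first exact: measurable_halfline.
  exact: integrable_weightM.
have intf : lebesgue_measure.-integrable `[x, M] (EFin \o f).
  apply: continuous_compact_integrable; first exact: segment_compact.
  apply/continuous_within_itvP => //; split.
  - by move=> t; rewrite in_itv/= => /andP[/(lt_trans x0) t0 _]; exact: cf.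
  - by apply: cvg_at_right_filter; exact: cf.
  - by apply: cvg_at_left_filter; exact: cf.
have : \int[lebesgue_measure]_(t in `[x, M]) (-1 * (weight a t * P.[t])) <=
       \int[lebesgue_measure]_(t in `[x, M]) f t.
  apply: le_Rintegral => //.
    apply: (eq_integrable mI _ _ _ (integrableZl mI (-1) intP)) => t _.
    by rewrite EFinM.
  by move=> t; rewrite /= in_itv/= => /andP[xt _]; exact: fP.
rewrite RintegralZl// [X in _ <= X]/Rintegral I /= => H1.
have H2 : \int[lebesgue_measure]_(t in `[x, M]) (weight a t * P.[t]) <=
    (2 + n%:R / x) * h.
  by rewrite -momP /Rintegral -lee_fin fineK// integrable_fin_num.
move: FM H1 H2; rewrite /F /p !hornerM -!expr2 -/L; lra.
Unshelve. all: by end_near. Qed.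

(** * Power series estimates near the origin *)

Lemma sum_exp_coeff_le (y : R) n : 0 <= y ->
  \sum_(m < n) y ^+ m / m`!%:R <= expR y.
Proof.
move=> y0; rewrite -(big_mkord xpredT (fun m => y ^+ m / m`!%:R)) /expR.
apply: (nondecreasing_cvgn_le (u_ := series (exp_coeff y))).
  apply: nondecreasing_series => m _ _.
  by rewrite exp_coeff_ge0.
exact: is_cvg_series_exp_coeff.
Qed.

Lemma lagpoly_coef0 a n : 0 <= a ->
  (lagpoly a n)`_0 = Gamma (n%:R + a + 1) / n`!%:R / Gamma (a + 1).
Proof.
move=> a0; rewrite coef_poly/= subn0 fact0 expr0 add0r divr1 mulr1 invfM.
by rewrite mulrAC -mulrA mulrA.
Qed.

(** The recurrence multiplies the modulus of a coefficient by (n - m) / ((m+1)(m+a+1)) <= n /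
    (m+1)^2. *)
Lemma coef_lagpoly_le a n m : 0 <= a ->
  `|(lagpoly a n)`_m| <= (lagpoly a n)`_0 * (n%:R ^+ m / (m`!%:R * m`!%:R)).
Proof.
move=> a0; have c0 : 0 <= (lagpoly a n)`_0.
  by rewrite lagpoly_coef0// !divr_ge0 ?Gamma_ge0.
elim: m => [|m IH]; first by rewrite fact0 expr0 mulr1 divr1 mulr1 ger0_norm.
have [nm|mn] := leqP n m.
  rewrite [X in `|X|]coef_poly ltnS ltnNge nm/= normr0.
  by rewrite !mulr_ge0 ?invr_ge0 ?mulr_ge0 ?exprn_ge0.
have m1 : 0 < m.+1%:R :> R by [].
have m2 : m.+1%:R <= m%:R + a + 1 by rewrite -natr1; lra.
have m3 : 0 < m.+1%:R * (m%:R + a + 1) by rewrite mulr_gt0// (lt_le_trans m1).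
rewrite -(ler_pM2l m3) -[X in X * `| _ |]ger0_norm ?(ltW m3)// -normrM.
rewrite coef_lagpolyS// normrM.
apply: (@le_trans _ _ (n%:R * ((lagpoly a n)`_0 * (n%:R ^+ m / (m`!%:R * m`!%:R))))).
  rewrite ler_pM// distrC ger0_norm ?subr_ge0 ?ler_nat 1?ltnW//.
  by rewrite gerBl.
have -> : n%:R * ((lagpoly a n)`_0 * (n%:R ^+ m / (m`!%:R * m`!%:R))) =
    (m.+1%:R * m.+1%:R) *
    ((lagpoly a n)`_0 * (n%:R ^+ m.+1 / ((m.+1)`!%:R * (m.+1)`!%:R))) :> R.
  rewrite factS natrM exprS.
  have f0 : m`!%:R != 0 :> R by rewrite pnatr_eq0 -lt0n fact_gt0.
  have m1' : m.+1%:R != 0 :> R by rewrite gt_eqF.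
  move: (lagpoly a n)`_0 n%:R (n%:R ^+ m) m`!%:R m.+1%:R f0 m1' => c y z u v u0 v0.
  by field; rewrite u0 v0.
rewrite ler_wpM2r//.
  by rewrite !mulr_ge0 ?invr_ge0 ?mulr_ge0 ?exprn_ge0.
by rewrite ler_wpM2l.
Qed.

(** Of the two factorials in [coef_lagpoly_le], one absorbs the factor [m] from differentiation and
    the other leaves the exponential series. *)
Lemma lagpoly_deriv_le a n x : 0 <= a -> 0 <= x ->
  `|x * (lagpoly a n)^`().[x]| <= (lagpoly a n)`_0 * expR (n%:R * x).
Proof.
move=> a0 x0.
have c0 : 0 <= (lagpoly a n)`_0.
  by rewrite lagpoly_coef0// !divr_ge0 ?Gamma_ge0.
have -> : x * (lagpoly a n)^`().[x] =
    \sum_(m < n.+1) m%:R * ((lagpoly a n)`_m * x ^+ m).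
  rewrite {1}/lagpoly poly_def raddf_sum horner_sum mulr_sumr.
  apply: eq_bigr => m _; rewrite /= derivZ derivXn hornerZ hornerMn hornerXn.
  rewrite coef_poly ltn_ord; move: (_ / _ * (_ / _)) => c.
  case: (nat_of_ord m) => [|k]; first by rewrite mulr0n !(mulr0, mul0r).
  by rewrite /= -mulr_natl exprS; ring.
have yn : 0 <= n%:R * x by rewrite mulr_ge0.
apply: (le_trans (ler_norm_sum _ _ _)).
apply: le_trans (ler_wpM2l c0 (sum_exp_coeff_le n.+1 yn)).
rewrite mulr_sumr; apply: ler_sum => m _.
rewrite !normrM (ger0_norm (ler0n _ _)) normrX (ger0_norm x0).
have f1 : 0 < m`!%:R :> R by rewrite ltr0n fact_gt0.
have fm : m%:R <= m`!%:R :> R by rewrite ler_nat fact_geq.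
apply: (@le_trans _ _
  (m`!%:R * ((lagpoly a n)`_0 * (n%:R ^+ m / (m`!%:R * m`!%:R)) * x ^+ m))).
  rewrite ler_pM// ?mulr_ge0 ?exprn_ge0//.
  by rewrite ler_wpM2r ?exprn_ge0// coef_lagpoly_le.
rewrite le_eqVlt; apply/orP; left; apply/eqP; rewrite exprMn.
move: (lagpoly a n)`_0 (n%:R ^+ m) (x ^+ m) m`!%:R f1 => c y z u u0.
by field; rewrite gt_eqF.
Qed.

Lemma lagpoly_near_le a n x : 0 <= a -> 0 <= x ->
  `|(lagpoly a n).[x] - (lagpoly a n)`_0| <= (lagpoly a n)`_0 * (expR (n%:R * x) - 1).
Proof.
move=> a0 x0.
have c0 : 0 <= (lagpoly a n)`_0.
  by rewrite lagpoly_coef0// !divr_ge0 ?Gamma_ge0.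
have yn : 0 <= n%:R * x by rewrite mulr_ge0.
have E : (lagpoly a n).[x] = \sum_(m < n.+1) (lagpoly a n)`_m * x ^+ m.
  rewrite {1}/lagpoly horner_poly; apply: eq_bigr => m _.
  by rewrite coef_poly ltn_ord.
rewrite E big_ord_recl expr0 mulr1 addrC addKr.
apply: (le_trans (ler_norm_sum _ _ _)).
apply: (@le_trans _ _ ((lagpoly a n)`_0 *
    (\sum_(m < n.+1) (n%:R * x) ^+ m / m`!%:R - 1))); last first.
  by rewrite ler_wpM2l// lerB// sum_exp_coeff_le.
rewrite big_ord_recl expr0 fact0 divr1 addrC addKr mulr_sumr.
apply: ler_sum => m _; rewrite normrM normrX (ger0_norm x0) lift0.
set k := m.+1.
have f1 : 0 < k`!%:R :> R by rewrite ltr0n fact_gt0.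
apply: (@le_trans _ _ ((lagpoly a n)`_0 * (n%:R ^+ k / (k`!%:R * k`!%:R)) * x ^+ k)).
  by rewrite ler_wpM2r ?exprn_ge0// coef_lagpoly_le.
rewrite exprMn -mulrA ler_wpM2l// mulrAC ler_wpM2l ?mulr_ge0 ?exprn_ge0//.
by rewrite lef_pV2 ?posrE ?mulr_gt0// ler_peMl ?ler1n ?fact_gt0.
Qed.

Lemma Gamma_ratio_gt0 a n : 0 <= a -> 0 < Gamma (n%:R + a + 1) / n`!%:R.
Proof.
move=> a0; apply: divr_gt0; last by rewrite ltr0n fact_gt0.
by apply: Gamma_gt0; rewrite lerDr addr_ge0.
Qed.

(** The second quantity is (x phi')^2 for phi = L sqrt(w), the other half of the energy used further
    out. With h the squared norm of L, the constant term of L is h / Gamma(a+1), so w L^2 is of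
    order (w h) h; the factor w h stays bounded because h grows like (n+1)^a while (n+1) x <= A. *)
Lemma lagpoly_small a A : 0 <= a -> 0 <= A -> exists2 C : R, 0 < C &
  forall n x, 0 < x -> (4 * n%:R + 2 * a + 2) * x <= A ->
  weight a x * (lagpoly a n).[x] ^+ 2 <= C * (Gamma (n%:R + a + 1) / n`!%:R) /\
  weight a x * (x * (lagpoly a n)^`().[x] + (a - x) / 2 * (lagpoly a n).[x]) ^+ 2
    <= C * (Gamma (n%:R + a + 1) / n`!%:R).
Proof.
move=> a0 A0; have [C1 C10 hC1] := Gamma_ratio_le a0.
have G0 : 0 < Gamma (a + 1) by rewrite Gamma_gt0// lerDr.
(* [K] times the constant coefficient dominates both the polynomial and x phi' / sqrt(w). The
   summand 1 in the constant below keeps it positive when [A = 0]. *)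
pose K := expR A * (1 + a / 2 + A / 2).
exists (C1 * A `^ a / Gamma (a + 1) ^+ 2 * K ^+ 2 + 1) => [|n x x0 xA].
  by rewrite ltr_wpDl// mulr_ge0 ?sqr_ge0// divr_ge0 ?sqr_ge0// mulr_ge0 ?powR_ge0// ltW.
have n0 : 0 <= n%:R :> R by [].
have n1A : n.+1%:R * x <= A.
  by apply: le_trans xA; rewrite ler_wpM2r ?(ltW x0)// -natr1; lra.
have nA : n%:R * x <= A by apply: le_trans n1A; rewrite ler_wpM2r ?(ltW x0)// ler_nat.
have xleA : x <= A by apply: le_trans n1A; rewrite ler_peMl ?(ltW x0)// ler1n.
set h := _ / n`!%:R; have h0 : 0 < h by exact: Gamma_ratio_gt0.
have key y : `|y| <= (lagpoly a n)`_0 * K ->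
    weight a x * y ^+ 2 <= (C1 * A `^ a / Gamma (a + 1) ^+ 2 * K ^+ 2 + 1) * h.
  move=> hy; have K0 : 0 <= K by rewrite mulr_ge0 ?expR_ge0//; lra.
  have y2 : y ^+ 2 <= (h / Gamma (a + 1) * K) ^+ 2.
    rewrite -[y ^+ 2]real_normK ?num_real// ler_pXn2r ?nnegrE ?normr_ge0//.
      by rewrite -lagpoly_coef0.
    by rewrite mulr_ge0// divr_ge0 ?ltW.
  have w1 : weight a x * h <= C1 * A `^ a.
    have e1 : expR (- x) <= 1 by rewrite expR_le1; lra.
    apply: (@le_trans _ _ (x `^ a * (C1 * n.+1%:R `^ a))).
      rewrite ler_pM ?weight_ge0 ?(ltW h0)//.
        by rewrite /weight ler_piMr ?powR_ge0.
      exact: hC1.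
    rewrite mulrCA -powRM ?(ltW x0)// ler_wpM2l ?(ltW C10)//.
    by rewrite ge0_ler_powR ?nnegrE ?mulr_ge0 ?(ltW x0)// mulrC.
  apply: (le_trans (ler_wpM2l (weight_ge0 _ _) y2)).
  have -> : weight a x * (h / Gamma (a + 1) * K) ^+ 2 =
    (weight a x * h) * (K ^+ 2 / Gamma (a + 1) ^+ 2 * h) by field; rewrite gt_eqF.
  apply: (@le_trans _ _ (C1 * A `^ a * (K ^+ 2 / Gamma (a + 1) ^+ 2 * h))).
    apply: ler_wpM2r => //; apply: mulr_ge0; last exact: ltW.
    by apply: divr_ge0; exact: sqr_ge0.
  rewrite mulrDl mul1r ler_wpDr ?(ltW h0)// le_eqVlt; apply/orP; left; apply/eqP.
  by move: (K ^+ 2) (Gamma (a + 1)) (C1 * _) => u v z; ring.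
set c := (lagpoly a n)`_0 in key *; have c0 : 0 <= c.
  by rewrite /c lagpoly_coef0// !divr_ge0 ?Gamma_ge0.
have eA : expR (n%:R * x) <= expR A by rewrite ler_expR.
have hL : `|(lagpoly a n).[x]| <= c * expR A.
  have := lagpoly_near_le n a0 (ltW x0); rewrite -/c => H.
  rewrite -[(lagpoly a n).[x]](subrK c) (le_trans (ler_normD _ _))//.
  rewrite (ger0_norm c0) (le_trans (lerD H (lexx c)))// mulrBr mulr1 subrK.
  by rewrite ler_wpM2l.
have hD := lagpoly_deriv_le n a0 (ltW x0); rewrite -/c in hD.
split; apply: key.
  apply: (le_trans hL); rewrite ler_wpM2l// /K ler_peMr ?expR_ge0//; lra.
apply: (le_trans (ler_normD _ _)).
apply: (@le_trans _ _ (c * expR A + (a + A) / 2 * (c * expR A))); last first.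
  by rewrite /K; lra.
apply: lerD; first by apply: (le_trans hD); rewrite ler_wpM2l.
rewrite normrM ler_pM// ler_norml; apply/andP; split; lra.
Qed.

(* The derivative of the energy [w (L^2 + B^2 / q)]: by the differential equation
   everything cancels except the term with [q1 = q']. *)
Lemma sonin_identity (w a k t L L1 L2 q q1 : R)
    (B := t * L1 + (a - t) / 2 * L)
    (B1 := L1 + t * L2 + a / 2 * L1 - 2^-1 * (L + t * L1)) :
  t != 0 -> t * L2 + ((a + 1) * L1 - t * L1) = - k * L ->
  q = ((4 * k + 2 * a + 2) * t - t ^+ 2 - a ^+ 2) / 4 -> q != 0 ->
  w * ((a / t - 1) * (L * L) + (L1 * L + L * L1)) +
  (w * (B * B) * (- q ^- 2 * q1) +
   q^-1 * (w * ((a / t - 1) * (B * B) + (B1 * B + B * B1)))) =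
  - (w * (B * B) * q1 / q ^+ 2).
Proof.
move=> t0 ode qE q0.
(* The differential equation eliminates the second derivative. *)
have B1E : B1 = - (a - t) / 2 * L1 - (k + 2^-1) * L by rewrite /B1; lra.
have e1 : (a / t - 1) * (L * L) + (L1 * L + L * L1) = 2 * L * B / t.
  by rewrite /B; field.
(* The formula for [q] is exactly what makes this, divided by [q], the opposite of [e1]. *)
have e2 : (a / t - 1) * (B * B) + (B1 * B + B * B1) = - 2 * q * B * L / t.
  by rewrite B1E qE /B; field.
rewrite e1 e2; move: (B) (B1) => u v; field.
by rewrite t0 q0.
Qed.

(** The energy [F] is nonincreasing up to nu/2, where q' = (nu - 2t)/4 changes sign. At [x] its
    second term is dropped; at [x0] the division by q >= 1 is. *)
Lemma lagpoly_sonin a n x0 x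
    (q := fun t => ((4 * n%:R + 2 * a + 2) * t - t ^+ 2 - a ^+ 2) / 4) :
  0 <= a -> 0 < x0 -> 1 <= q x0 -> x0 <= x -> x <= (4 * n%:R + 2 * a + 2) / 2 ->
  weight a x * (lagpoly a n).[x] ^+ 2 <=
  weight a x0 * (lagpoly a n).[x0] ^+ 2 +
  weight a x0 * (x0 * (lagpoly a n)^`().[x0] + (a - x0) / 2 * (lagpoly a n).[x0]) ^+ 2.
Proof.
move=> a0 x00 q0 x0x xv; set L := lagpoly a n.
pose nu := 4 * n%:R + 2 * a + 2.
have nuE : 4 * n%:R + 2 * a + 2 = nu by [].
have hE := (hornerD, hornerN, hornerZ, hornerM, hornerX, hornerC).
pose B := 'X * L^`() + (a / 2)%:P * L - 2^-1 *: ('X * L).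
have BE t : B.[t] = t * L^`().[t] + (a - t) / 2 * L.[t].
  by rewrite /B !hE; field.
have dBE t : B^`().[t] = L^`().[t] + t * L^`()^`().[t] + a / 2 * L^`().[t]
      - 2^-1 * (L.[t] + t * L^`().[t]).
  rewrite /B !(derivD, derivN, derivZ, derivM, derivX, derivC) mul0r add0r mul1r.
  by rewrite ?mul1r !hE; ring.
clearbody B.
pose Q := 4^-1 *: (nu *: 'X - 'X * 'X - (a ^+ 2)%:P).
have QE t : Q.[t] = q t by rewrite /Q /q !hE /nu; field.
have dQE t : Q^`().[t] = (nu - 2 * t) / 4.
  rewrite /Q derivZ !derivB derivZ derivM derivX derivC !hE ?hornerC; by field.
clearbody Q.
(* 4 (q(t) - q(x0)) = (t - x0)(nu - t - x0), and both factors are nonnegative when x0 <= t <=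
   nu/2. *)
have qge t : x0 <= t <= nu / 2 -> 1 <= Q.[t].
  move=> /andP[xt tn]; rewrite QE (le_trans q0)// /q nuE.
  have : 0 <= (t - x0) * (nu - t - x0) by rewrite mulr_ge0//; lra.
  lra.
pose F t := weight a t * (L * L).[t] + weight a t * (B * B).[t] * Q.[t]^-1.
pose dF t := weight a t * ((a / t - 1) * (L * L).[t] + (L * L)^`().[t]) +
  (weight a t * (B * B).[t] * (- Q.[t] ^- 2 * Q^`().[t]) +
   Q.[t]^-1 * (weight a t * ((a / t - 1) * (B * B).[t] + (B * B)^`().[t]))).
have hF t : x0 <= t <= nu / 2 -> is_derive t 1 F (dF t).
  move=> /[dup] /qge q1 /andP[xt _]; have t0 := lt_le_trans x00 xt.
  have q' : Q.[t] != 0 by rewrite gt_eqF// (lt_le_trans _ q1).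
  have h1 := is_derive_weight_poly a (L * L) t0.
  have h2 := is_derive_weight_poly a (B * B) t0.
  have h3 := @is_deriveV R (horner Q) t _ 1 q' (is_derive_poly Q t).
  exact: (is_deriveD h1 (is_deriveM h2 h3)).
have dF0 t : x0 <= t <= nu / 2 -> dF t <= 0.
  move=> /[dup] /qge q1 /andP[xt tn]; have t0 := lt_le_trans x00 xt.
  have q' : Q.[t] != 0 by rewrite gt_eqF// (lt_le_trans _ q1).
  have ode : t * L^`()^`().[t] + ((a + 1) * L^`().[t] - t * L^`().[t]) = - n%:R * L.[t].
    by have := congr1 (fun p => p.[t]) (lagpoly_ode n a0); rewrite !hE.
  rewrite /dF !derivM !hE BE dBE.
  rewrite (sonin_identity (weight a t) Q^`().[t] _ ode (QE t) q') ?gt_eqF//.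
  rewrite oppr_le0 divr_ge0 ?sqr_ge0// mulr_ge0//.
    by rewrite mulr_ge0 ?weight_ge0// -expr2 sqr_ge0.
  by rewrite dQE divr_ge0//; lra.
have Fmono : F x <= F x0.
  apply: (@ler0_derive1_nincr R F x0 (nu / 2)) => //.
  - move=> t; rewrite in_itv/= => /andP[/ltW x0t /ltW tn].
    by have [] := hF t; rewrite ?x0t ?tn.
  - move=> t; rewrite in_itv/= => /andP[/ltW x0t /ltW tn].
    have tI : x0 <= t <= nu / 2 by rewrite x0t tn.
    by rewrite derive1E; have [_ ->] := hF t tI; exact: dF0.
  - apply: derivable_within_continuous => t; rewrite in_itv/= => tI.
    by have [] := hF t tI.
have w0 := weight_ge0 a x0; have wx := weight_ge0 a x.
have qx : 1 <= Q.[x] by apply: qge; rewrite x0x.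
have qx0 : 1 <= Q.[x0] by rewrite QE.
have h1 : weight a x * L.[x] ^+ 2 <= F x.
  have qi : 0 <= Q.[x]^-1 by rewrite invr_ge0 (le_trans _ qx).
  rewrite /F hE -expr2 lerDl; apply: mulr_ge0 => //.
  by rewrite hE -expr2 mulr_ge0 ?sqr_ge0.
apply: (le_trans h1); apply: (le_trans Fmono).
rewrite /F !hE -!expr2 BE lerD2l; apply: ler_piMr.
  by rewrite mulr_ge0 ?sqr_ge0.
by rewrite invf_le1// (lt_le_trans ltr01).
Qed.

Lemma lagpoly_bound a : 0 <= a -> exists2 C : R, 0 < C & forall n x, 0 < x ->
  weight a x * (lagpoly a n).[x] ^+ 2 <= C * (Gamma (n%:R + a + 1) / n`!%:R).
Proof.
(* [A] makes [q >= 1] at [A / nu], where [lagpoly_small] takes over. *)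
move=> a0; pose A : R := 2 * a ^+ 2 + 8.
have A0 : 0 <= A by rewrite addr_ge0// mulr_ge0 ?sqr_ge0.
have [C C0 hC] := lagpoly_small a0 A0.
exists (2 * C + 4) => [|n x x0]; first by lra.
have h0 := Gamma_ratio_gt0 n a0.
have hC1 xA := proj1 (hC n x x0 xA).
have far := lagpoly_sqr_le_far n a0 x0.
move: h0 (hC n) hC1 far; set h := _ / n`!%:R; clearbody h => h0 {}hC hC1 far.
set nu := 4 * n%:R + 2 * a + 2 in hC hC1 *.
have n0 : 0 <= n%:R :> R by [].
have nu0 : 0 < nu by rewrite /nu; lra.
have hC0 : 0 <= C * h by rewrite mulr_ge0 ?ltW.
have [xA|xA] := leP (nu * x) A; first by have := hC1 xA; lra.
have [xnu|xnu] := leP (nu / 2) x.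
  apply: (le_trans far); rewrite ler_wpM2r ?(ltW h0)//.
  have : n%:R / x <= 1 by rewrite ler_pdivrMr// mul1r; move: xnu; rewrite /nu; lra.
  lra.
pose x1 := A / nu; have x10 : 0 < x1.
  by rewrite divr_gt0// /A ltr_wpDl// mulr_ge0 ?sqr_ge0.
have nux1 : nu * x1 = A by rewrite /x1 mulrCA divff ?gt_eqF// mulr1.
have x1x : x1 <= x by rewrite /x1 ler_pdivrMr// mulrC ltW.
have [h1 h2] : _ /\ _ := hC x1 x10 (eq_ind_r (fun z => z <= A) (lexx A) nux1).
(* Since x1 <= nu/2, nu x1 - x1^2 >= A/2, and A/2 - a^2 = 4. *)
have q1 : 1 <= (nu * x1 - x1 ^+ 2 - a ^+ 2) / 4.
  have : x1 * x1 <= x1 * (nu / 2) by rewrite ler_wpM2l ?(ltW x10)//; lra.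
  have -> : x1 * (nu / 2) = A / 2 by rewrite -nux1; ring.
  by rewrite nux1 -expr2 /A; lra.
have := lagpoly_sonin a0 x10 q1 x1x (ltW xnu); lra.
Qed.

(** As exp(1/4) <= 3/2, the polynomial deviates from its constant term by at most half of it. *)
Lemma lagpoly_ge a n x : 0 <= a -> 0 <= x -> n%:R * x <= 4^-1 ->
  (lagpoly a n)`_0 / 2 <= (lagpoly a n).[x].
Proof.
move=> a0 x0 nx.
have c0 : 0 <= (lagpoly a n)`_0.
  by rewrite lagpoly_coef0// !divr_ge0 ?Gamma_ge0.
have := lagpoly_near_le n a0 x0; move: (lagpoly a n).[x] (lagpoly a n)`_0 c0 => u c c0.
have e1 : expR (n%:R * x) <= 3 / 2.
  rewrite (@le_trans _ _ (expR 4^-1)) ?ler_expR//.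
  have := expR_ge1Dx (- 4^-1 : R); have e0 := expR_gt0 (4^-1 : R).
  rewrite expRN -(ler_pM2l e0) mulfV ?gt_eqF//; lra.
have : c * (expR (n%:R * x) - 1) <= c * (2^-1) by rewrite ler_wpM2l//; lra.
rewrite ler_norml => h /andP[]; lra.
Qed.

End laguerre_bounds.

(** * Sequence norms *)

Section lnorm.
Context {R : realType}.
Implicit Types (x : nat -> R) (T r b : R) (p : \bar R).

(** Only the empty set is null for the counting measure, so the essential supremum is a true
    supremum. *)
Lemma lnormyP x T : (lnorm +oo%E x <= T%:E)%E <-> forall k, `|x k| <= T.
Proof.
have c0 : (0 < @counting _ R [set: nat])%E.
  by rewrite /counting asboolF ?ltry//; exact: infinite_nat.
rewrite /lnorm Lnorm.unlock c0; split=> [/ess_supP [A /= [_ A0 hA]] k|h]; last first.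
  by apply/ess_supP; apply: nearW => k; rewrite /= lee_fin.
apply: contrapT => xk; have Ak : A k by apply: hA => /=; rewrite lee_fin.
move: A0; rewrite /counting; case: ifPn => // /asboolP finA [] /eqP.
rewrite pnatr_eq0 cardfs_eq0 => /eqP/fsetP/(_ k).
by rewrite in_fset_set// inE mem_set.
Qed.

Lemma lnorm_finE r x : 1 <= r ->
  lnorm r%:E x = ((\sum_(k <oo) (`|x k| `^ r)%:E) `^ r^-1)%E.
Proof.
by move=> r1; rewrite /lnorm Lnorm_counting ?(lt_le_trans _ r1).
Qed.

Lemma lnorm_fin_le r x T n : 1 <= r -> 0 <= T -> (lnorm r%:E x <= T%:E)%E ->
  \sum_(0 <= k < n) `|x k| `^ r <= T `^ r.
Proof.
move=> r1 T0; rewrite lnorm_finE// => h.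
have r0 : 0 < r by apply: lt_le_trans r1.
have S0 : 0 <= \sum_(0 <= k < n) `|x k| `^ r by apply: sumr_ge0 => k _; exact: powR_ge0.
have h1 : ((\sum_(0 <= k < n) `|x k| `^ r) `^ r^-1 <= T).
  rewrite -lee_fin; apply: le_trans h; rewrite -poweR_EFin.
  apply: gt0_ler_poweR.
  - by rewrite invr_ge0 ltW.
  - by rewrite in_itv/= lee_fin S0 leey.
  - rewrite in_itv/= leey andbT; apply: nneseries_ge0 => k _ _.
    by rewrite lee_fin powR_ge0.
  rewrite -sumEFin; apply: nneseries_lim_ge => k _ _.
  by rewrite lee_fin powR_ge0.
have := @ge0_ler_powR R r (ltW r0) _ _ _ _ h1.
rewrite -powRrM mulVf ?gt_eqF// powRr1//; apply; rewrite nnegrE//.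
exact: powR_ge0.
Qed.

Lemma le_powR1D r (y : R) : 1 <= r -> 0 <= y -> y <= 1 + y `^ r.
Proof.
move=> r1 y0; have [y1|y1] := leP y 1; first by rewrite ler_wpDr ?powR_ge0.
by apply: (le_trans (le1r_powR (ltW y1) r1)); rewrite lerDr.
Qed.

(* Hoelder's inequality up to the factor 2, by [y <= 1 + y^r] instead of Young. *)
Lemma lnorm_sum_le p x T (m n : nat) : (1%:E <= p)%E -> 0 < T -> (m < n)%N ->
  (lnorm p x <= T%:E)%E ->
  \sum_(m <= k < n) `|x k| <= 2 * (n - m)%:R `^ (1 - recip p) * T.
Proof.
case: p => [r p1|_|//] T0 mn hT; last first.
  move/lnormyP: hT => hT; rewrite /recip subr0 powRr1//.
  apply: (@le_trans _ _ (\sum_(m <= k < n) T)); first by apply: ler_sum => k _.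
  rewrite sumr_const_nat -[T *+ _]mulr_natl ler_wpM2r ?(ltW T0)// ler_peMl//.
  by rewrite ler1n.
rewrite lee_fin in p1; rewrite /recip; set N : R := (n - m)%:R.
have r0 : 0 < r by apply: lt_le_trans p1.
have N0 : 0 < N by rewrite ltr0n subn_gt0.
(* At this scale the two parts of y <= 1 + y^r, applied to |x_k| / l and summed, each contribute l N
   = N^(1-1/r) T. *)
pose l := T / N `^ r^-1.
have l0 : 0 < l by rewrite divr_gt0// powR_gt0.
have lr : l `^ r = T `^ r / N.
  rewrite /l powRM ?(ltW T0) ?invr_ge0 ?powR_ge0//.
  by rewrite -powRN -powRrM mulNr mulVf ?gt_eqF// powR_inv1// ltW.
have lV : l^-1 `^ r = (l `^ r)^-1.
  by rewrite -(powR_inv1 (ltW l0)) -powRrM mulN1r powRN.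
have hS := lnorm_fin_le n p1 (ltW T0) hT.
have hS' : \sum_(m <= k < n) `|x k| `^ r <= T `^ r.
  apply: le_trans hS; rewrite [leRHS](big_cat_nat (n := m))//= ?(ltnW mn)// lerDr.
  by apply: sumr_ge0 => k _; exact: powR_ge0.
apply: (@le_trans _ _ (\sum_(m <= k < n) (l + l * (`|x k| `^ r / l `^ r)))).
  apply: ler_sum => k _.
  have := @le_powR1D r (`|x k| / l) p1 (divr_ge0 (normr_ge0 _) (ltW l0)).
  rewrite powRM ?invr_ge0 ?(ltW l0)// lV ler_pdivrMr// mulrDl mul1r.
  by rewrite [_ * l]mulrC.
rewrite big_split/= sumr_const_nat -mulr_sumr -mulr_suml.
apply: (@le_trans _ _ (l * N + l * (T `^ r / l `^ r))).
  rewrite -[l *+ _]mulr_natr lerD2l ler_wpM2l ?(ltW l0)// ler_wpM2r ?invr_ge0 ?powR_ge0//.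
have -> : T `^ r / l `^ r = N.
  by rewrite lr invf_div mulrCA divff ?gt_eqF ?powR_gt0// mulr1.
rewrite /l powRB; last by rewrite (gt_eqF N0) implybT.
rewrite powRr1 ?(ltW N0)//.
rewrite le_eqVlt; apply/orP; left; apply/eqP.
by field; rewrite gt_eqF// powR_gt0.
Qed.

Lemma lnorm_supp_le p x b (s : seq nat) : (1%:E <= p)%E -> 0 <= b -> uniq s ->
  (forall k, `|x k| <= if k \in s then b else 0) ->
  (lnorm p x <= ((size s)%:R `^ recip p * b)%:E)%E.
Proof.
case: p => [r p1|_|//] b0 us hx; last first.
  rewrite /recip powRr0 mul1r; apply/lnormyP => k.
  by apply: (le_trans (hx k)); case: ifP.
rewrite lee_fin in p1; rewrite /recip lnorm_finE//.
have r0 : 0 < r by apply: lt_le_trans p1.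
have -> : (size s)%:R `^ r^-1 * b = ((size s)%:R * b `^ r) `^ r^-1.
  by rewrite powRM ?powR_ge0// -powRrM divff ?gt_eqF// powRr1.
rewrite -poweR_EFin; apply: gt0_ler_poweR.
- by rewrite invr_ge0 ltW.
- rewrite in_itv/= leey andbT; apply: nneseries_ge0 => k _ _.
  by rewrite lee_fin powR_ge0.
- by rewrite in_itv/= leey lee_fin mulr_ge0// powR_ge0.
apply: lime_le; first by apply: is_cvg_nneseries => k _ _; rewrite lee_fin powR_ge0.
apply: nearW => n; rewrite sumEFin lee_fin.
apply: (@le_trans _ _ (\sum_(0 <= k < n | k \in s) b `^ r)).
  rewrite [leRHS]big_mkcond/=; apply: ler_sum => k _.
  have := hx k; case: ifP => _ h.
    by rewrite ge0_ler_powR ?nnegrE// ltW.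
  have -> : `|x k| = 0 by apply/eqP; rewrite eq_le h normr_ge0.
  by rewrite powR0// gt_eqF.
rewrite -big_filter big_const_seq count_predT iter_addr_0 -[_ *+ size _]mulr_natl.
rewrite ler_wpM2r ?powR_ge0// ler_nat; apply: uniq_leq_size.
  by rewrite filter_uniq// iota_uniq.
by move=> k; rewrite mem_filter => /andP[].
Qed.

End lnorm.

(** * Normalized Laguerre functions *)

Definition nlagpoly (R : realType) (a : R) (k : nat) : {poly R} :=
  Num.sqrt (k`!%:R / Gamma (k%:R + a + 1)) *: lagpoly a k.

Section normalized_laguerre.
Context {R : realType}.
Implicit Types (a t : R) (k n : nat).

Lemma nlaguerreE a k t : nlaguerre a k t = (nlagpoly a k).[t].
Proof. by rewrite hornerZ -laguerreE. Qed.

Lemma mom_nlagpoly a j k : 0 <= a ->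
  mom a (nlagpoly a j * nlagpoly a k) = (j == k)%:R.
Proof.
move=> a0; rewrite /nlagpoly -scalerAl -scalerAr !momZ//.
have [<-|/(mom_lagpoly_orth a0) ->] := eqVneq j k; last by rewrite mulr0 mulr0.
rewrite mom_lagpoly_sqr// mulrA -expr2 sqr_sqrtr.
  by rewrite -invf_div mulVf// gt_eqF// Gamma_ratio_gt0.
by rewrite -invf_div invr_ge0 ltW// Gamma_ratio_gt0.
Qed.

Lemma coef_horner a (p : {poly R}) k : coef a (horner p) k = mom a (p * nlagpoly a k).
Proof.
by apply: eq_Rintegral => t _; rewrite hornerM nlaguerreE mulrA.
Qed.

Lemma L2w_horner a (p : {poly R}) : 0 <= a -> L2w a (horner p).
Proof.
move=> a0; split.
  by apply: measurable_funTS; apply: continuous_measurable_fun; exact: continuous_horner.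
have := integrable_weightM (p * p) a0.
by under [X in _ -> integrable _ _ X]eq_fun do rewrite expr2 -hornerM.
Qed.

Lemma nlaguerre_bound a : 0 <= a -> exists2 C : R, 0 < C &
  forall k t, 0 < t -> `|nlaguerre a k t * Num.sqrt (weight a t)| <= C.
Proof.
move=> /[dup] a0 /lagpoly_bound [C C0 hC].
exists (C + 1) => [|k t t0]; first by rewrite ltr_wpDl// ltW.
have h0 := Gamma_ratio_gt0 k a0.
have : (nlaguerre a k t * Num.sqrt (weight a t)) ^+ 2 <= C.
  rewrite nlaguerreE hornerZ !exprMn !sqr_sqrtr ?weight_ge0//; last first.
    by rewrite -invf_div invr_ge0 ltW.
  by rewrite -invf_div -mulrA mulrC ler_pdivrMr// [_ * weight a t]mulrC hC.
(* [C + 1] spares a square root: y^2 <= C implies |y| <= C + 1. *)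
move: (_ * Num.sqrt _) => y y2; rewrite ler_norml; apply/andP; split; nra.
Qed.

(** At t = 1/(16M) one has k t <= 1/4, so [lagpoly_ge] applies. With h the squared norm of L_k,
    normalization leaves sqrt(h w(t)) / (2 Gamma(a+1)), and h w(t) is bounded below since h >= c
    (k+1)^a, (k+1) t >= 1/16 and t <= 1. *)
Lemma nlaguerre_ge a : 0 <= a -> exists2 c : R, 0 < c &
  forall M k, (0 < M)%N -> (M <= k <= 4 * M)%N ->
  c <= nlaguerre a k (16 * M%:R)^-1 * Num.sqrt (weight a (16 * M%:R)^-1).
Proof.
move=> /[dup] a0 /Gamma_ratio_ge [c c0 hc].
have G0 : 0 < Gamma (a + 1) by rewrite Gamma_gt0// lerDr.
pose d := c * 16^-1 `^ a * expR (- 1).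
have d0 : 0 < d by rewrite !mulr_gt0 ?powR_gt0 ?expR_gt0 ?invr_gt0.
exists (Num.sqrt d / (2 * Gamma (a + 1))) => [|M k M0 /andP[Mk k4M]].
  by rewrite divr_gt0 ?sqrtr_gt0 ?mulr_gt0.
have M0' : 0 < M%:R :> R by rewrite ltr0n.
set t := (16 * _)^-1.
have t0 : 0 < t by rewrite invr_gt0 mulr_gt0.
have tk : k%:R * t <= 4^-1.
  have : k%:R <= 4 * M%:R :> R by rewrite -natrM ler_nat.
  move=> k4; rewrite /t ler_pdivrMr ?mulr_gt0//; lra.
have h0 := Gamma_ratio_gt0 k a0; have hk := hc k.
have Lge := lagpoly_ge a0 (ltW t0) tk; rewrite lagpoly_coef0// in Lge.
rewrite nlaguerreE hornerZ.
move: h0 hk Lge; rewrite -[k`!%:R / _]invf_div; set h := Gamma (k%:R + a + 1) / k`!%:R.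
move: h => h h0 hk Lge.
have wh : d <= h * weight a t.
  apply: (@le_trans _ _ (c * k.+1%:R `^ a * weight a t)); last first.
    by rewrite ler_wpM2r ?weight_ge0.
  rewrite /d /weight -!mulrA ler_wpM2l ?(ltW c0)// mulrA -powRM ?(ltW t0)//.
  rewrite ler_pM ?powR_ge0 ?expR_ge0//.
    rewrite ge0_ler_powR ?nnegrE ?invr_ge0 ?mulr_ge0 ?(ltW t0)//.
    rewrite /t invfM mulrCA ler_peMr ?invr_ge0// ler_pdivlMr// mul1r.
    by rewrite ler_nat ltnW.
  rewrite ler_expR lerN2 /t invf_le1 ?mulr_gt0//.
  have : 1 <= M%:R :> R by rewrite ler1n.
  lra.
have sw : Num.sqrt d <= Num.sqrt h * Num.sqrt (weight a t).
  by rewrite -sqrtrM ?(ltW h0)// ler_wsqrtr.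
apply: (@le_trans _ _ (Num.sqrt h * Num.sqrt (weight a t) / (2 * Gamma (a + 1)))).
  by rewrite ler_wpM2r// invr_ge0 mulr_ge0// ltW.
have -> : Num.sqrt h * Num.sqrt (weight a t) / (2 * Gamma (a + 1)) =
    Num.sqrt h^-1 * (h / Gamma (a + 1) / 2) * Num.sqrt (weight a t).
  have -> : h / Gamma (a + 1) / 2 = Num.sqrt h ^+ 2 / Gamma (a + 1) / 2.
    by rewrite sqr_sqrtr// ltW.
  rewrite sqrtrV ?(ltW h0)//.
  have : Num.sqrt h != 0 by rewrite gt_eqF// sqrtr_gt0.
  move: (Num.sqrt h) (Num.sqrt _) => u v u0; field.
  by rewrite u0 gt_eqF.
by rewrite ler_wpM2r ?sqrtr_ge0// ler_wpM2l ?sqrtr_ge0.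
Qed.

End normalized_laguerre.

(** * The minimal radius *)

Section radius_bounds.
Context {R : realType}.
Context (alpha mu : R) (s p : \bar R).
Context (alpha0 : 0 <= alpha) (s1 : (1%:E <= s)%E) (p1 : (1%:E <= p)%E).
Context (hmu : 1 - recip s < mu) (mu0 : 0 < mu).

Local Notation gam := (mu + recip s - 1).

Let gam0 : 0 < gam. Proof. by move: hmu; lra. Qed.

Lemma recip_itv (q : \bar R) : (1%:E <= q)%E -> 0 <= recip q <= 1.
Proof.
case: q => [r|_|//]; last by rewrite lexx ler01.
rewrite lee_fin /recip => r1; have r0 : 0 < r by apply: lt_le_trans r1.
by rewrite invr_ge0 (ltW r0) invf_le1.
Qed.

(** Hoelder on the block costs m^(1-1/s), and the weights there are at least m^mu. *)
Lemma coef_block_le f m : (0 < m)%N -> (wnorm alpha s mu f <= 1)%E ->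
  \sum_(m <= k < 2 * m) `|coef alpha f k| <= 2 * m%:R `^ (- gam).
Proof.
move=> m0 hf; have m0' : 0 < m%:R :> R by rewrite ltr0n.
have m2 : (m < 2 * m)%N by rewrite mul2n -addnn -[X in (X < _)%N]addn0 ltn_add2l.
have := @lnorm_sum_le R s _ 1 m (2 * m) s1 ltr01 m2 hf.
rewrite mulr1 (_ : (2 * m - m = m)%N); last by rewrite mul2n -addnn addnK.
move=> h.
have : m%:R `^ mu * \sum_(m <= k < 2 * m) `|coef alpha f k| <= 2 * m%:R `^ (1 - recip s).
  apply: le_trans h; rewrite mulr_sumr big_nat_cond [leRHS]big_nat_cond.
  apply: ler_sum => k /andP[/andP[mk _] _].
  rewrite normrM normr_id ler_wpM2r// ger0_norm ?powR_ge0//.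
  rewrite ge0_ler_powR ?nnegrE ?(ltW mu0)// ler_nat.
  by rewrite (leq_trans mk)// leq_maxr.
rewrite -ler_pdivlMl ?powR_gt0// => /le_trans; apply.
rewrite mulrCA ler_wpM2l// -powRN -powRD ?(gt_eqF m0') ?implybT//.
by rewrite le_eqVlt; apply/orP; left; apply/eqP; congr (_ `^ _); ring.
Qed.

(** The bounds on dyadic blocks form a geometric series of ratio [q < 1]. [K] solves 2 + K q = K, so
    that the induction on the number of blocks closes. *)
Lemma coef_tail_le : exists2 K : R, 0 < K & forall f, (wnorm alpha s mu f <= 1)%E ->
  forall m n, (0 < m)%N -> \sum_(m <= k < n) `|coef alpha f k| <= K * m%:R `^ (- gam).
Proof.
have q1 : 2 `^ (- gam) < 1 :> R.
  rewrite powRN invf_lt1 ?powR_gt0//.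
  by have := @gt0_ltr_powR R gam gam0 1 2; rewrite powR1 !nnegrE; apply; rewrite ?ltr1n.
set q := 2 `^ (- gam) in q1; pose K := 2 / (1 - q).
have K0 : 0 < K by rewrite divr_gt0// subr_gt0.
have Kq : 2 + K * q = K.
  by rewrite /K; field; rewrite gt_eqF// subr_gt0.
exists K => // f hf m n m0.
have dyadic j : forall m, (0 < m)%N ->
    \sum_(m <= k < 2 ^ j * m) `|coef alpha f k| <= K * m%:R `^ (- gam).
  elim: j => [|j IH] {m0}m m0.
    by rewrite mul1n big_geq// mulr_ge0 ?powR_ge0 ?ltW.
  have m2 : (m <= 2 * m)%N by rewrite leq_pmull.
  rewrite (big_cat_nat (n := 2 * m))//=; last first.
    by rewrite expnSr -mulnA leq_pmull// expn_gt0.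
  rewrite expnSr -mulnA.
  apply: le_trans (lerD (coef_block_le m0 hf) (IH (2 * m)%N _)) _.
    by rewrite muln_gt0.
  by rewrite natrM powRM// -/q mulrA -mulrDl Kq.
(* Since n < 2^n, [n] doublings of [m] pass the index [n]. *)
apply: le_trans (dyadic n m m0).
have [nm|mn] := leqP n m.
  by rewrite [leLHS]big_geq// sumr_ge0.
rewrite [leRHS](big_cat_nat (n := n))//= ?(ltnW mn)//.
  by rewrite lerDl sumr_ge0.
by rewrite (leq_trans (ltnW (ltn_expl n (ltnSn 1))))// leq_pmulr.
Qed.

Lemma cvgn_crep f t : 0 < t -> (wnorm alpha s mu f <= 1)%E ->
  cvgn (series (fun k =>
    coef alpha f k * nlaguerre alpha k t * Num.sqrt (weight alpha t))).
Proof.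
move=> t0 hf; have [C C0 hC] := nlaguerre_bound alpha0.
have [K K0 hK] := coef_tail_le.
apply: normed_cvg; apply: nondecreasing_is_cvgn.
  by apply: nondecreasing_series => k _ _; exact: normr_ge0.
exists (C * (`|coef alpha f 0| + K * 1)) => _ [n _ <-].
have : \sum_(0 <= k < n) `|coef alpha f k| <= `|coef alpha f 0| + K * 1.
  case: n => [|n]; first by rewrite big_geq// addr_ge0// mulr_ge0 ?ltW.
  rewrite big_ltn// lerD2l; have := hK f hf 1%N n.+1 (ltn0Sn 0).
  by rewrite powR1.
move=> h; rewrite /series/= (le_trans _ (ler_wpM2l (ltW C0) h))// mulr_sumr.
apply: ler_sum => k _.
by rewrite -mulrA normrM mulrC ler_wpM2r// hC.
Qed.

(** The error splits into the noise in the first [N] coefficients and the tail of [f], with the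
    functions phi_k bounded uniformly. The estimate is shown for partial sums of length at least [N]
    and passes to the limit. *)
Lemma crep_error_le : exists2 C : R, 0 < C & forall f g N (t : R), (0 < N)%N -> 0 < t ->
  (wnorm alpha s mu f <= 1)%E ->
  `|crep alpha f t - (\sum_(0 <= k < N) coef alpha g k * nlaguerre alpha k t)
      * Num.sqrt (weight alpha t)| <=
  C * (\sum_(0 <= k < N) `|coef alpha g k - coef alpha f k| + N%:R `^ (- gam)).
Proof.
have [C C0 hC] := nlaguerre_bound alpha0.
have [K K0 hK] := coef_tail_le.
exists (C * (1 + K)) => [|f g N t N0 t0 hf]; first by rewrite mulr_gt0// addr_gt0.
set B := _ * Num.sqrt _; set S := \sum_(0 <= k < N) `|_ - _|; set T := N%:R `^ _.
have S0 : 0 <= S by exact: sumr_ge0.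
have T0 : 0 <= T by exact: powR_ge0.
pose u k := coef alpha f k * nlaguerre alpha k t * Num.sqrt (weight alpha t).
have cu : cvgn (series u) by exact: cvgn_crep.
have near_le n : (N <= n)%N -> `|series u n - B| <= C * (1 + K) * (S + T).
  move=> Nn; rewrite /series/= (big_cat_nat (n := N))//=.
  have -> : \sum_(0 <= k < N) u k + \sum_(N <= k < n) u k - B =
    (\sum_(0 <= k < N) (coef alpha f k - coef alpha g k) *
       (nlaguerre alpha k t * Num.sqrt (weight alpha t)))
    + \sum_(N <= k < n) coef alpha f k *
       (nlaguerre alpha k t * Num.sqrt (weight alpha t)).
    rewrite addrAC; congr (_ + _); last by apply: eq_bigr => k _; rewrite mulrA.
    rewrite /B mulr_suml -sumrB; apply: eq_bigr => k _.
    by rewrite /u; ring.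
  rewrite (le_trans (ler_normD _ _))//.
  apply: (@le_trans _ _ (C * S + C * (K * T))).
    apply: lerD.
      rewrite (le_trans (ler_norm_sum _ _ _))// /S mulr_sumr.
      apply: ler_sum => k _; rewrite normrM distrC mulrC ler_wpM2r//.
      exact: hC.
    apply: (@le_trans _ _ (C * \sum_(N <= k < n) `|coef alpha f k|)).
      rewrite (le_trans (ler_norm_sum _ _ _))// mulr_sumr.
      apply: ler_sum => k _; rewrite normrM mulrC ler_wpM2r//.
      exact: hC.
    by rewrite ler_wpM2l ?(ltW C0)// hK.
  rewrite -mulrDr -mulrA ler_wpM2l ?(ltW C0)//.
  have : 0 <= K * S by rewrite mulr_ge0// ltW.
  lra.
rewrite /crep -/u ler_distl; apply/andP; split.
  apply: limr_ge => //; near=> n.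
  have /near_le : (N <= n)%N by near: n; exact: nbhs_infty_ge.
  by rewrite ler_distl => /andP[].
apply: limr_le => //; near=> n.
have /near_le : (N <= n)%N by near: n; exact: nbhs_infty_ge.
by rewrite ler_distl => /andP[].
Unshelve. all: by end_near. Qed.

(** The method observes the first [N] coefficients and sums them up; Hoelder turns noise [delta] in
    l_p into 2 N^(1-1/p) delta in l_1. The reconstruction omits sqrt(w), which the definition of the
    error supplies. *)
Lemma galerkin_radius_le : exists2 C : R, 0 < C &
  forall (N : nat) (delta : R), (0 < N)%N -> 0 < delta ->
  (galerkin_radius alpha s mu p N delta <=
    (C * (N%:R `^ (1 - recip p) * delta + N%:R `^ (- gam)))%:E)%E.
Proof.
have [C C0 hC] := crep_error_le.
exists (2 * C) => [|N delta N0 d0]; first by rewrite mulr_gt0.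
pose Om : {fset nat} := [fset k in iota 0 N]%fset.
pose psi (x : nat -> R) t := \sum_(0 <= k < N) x k * nlaguerre alpha k t.
have memOm k : (k \in Om) = (k < N)%N by rewrite !inE mem_iota.
pose A := psi \o galerkin alpha Om.
have AP : Psi alpha N A.
  exists Om, psi; split => //.
    rewrite -[leqRHS](size_iota 0); apply: (uniq_leq_size (fset_uniq _)) => k.
    by rewrite mem_iota add0n -memOm.
  move=> x _; rewrite /spaceC/=.
  rewrite (_ : psi x = horner (\sum_(0 <= k < N) x k *: nlagpoly alpha k)).
    by apply: continuous_subspaceT; exact: continuous_horner.
  apply/funext => t; rewrite horner_sum; apply: eq_bigr => k _.
  by rewrite hornerZ nlaguerreE.
apply: (@le_trans _ _ (recovery_error alpha s mu p delta A)).
  by apply: ereal_inf_lbound; exists A.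
apply: ge_ereal_sup => _ [f [Lf Wf] <-].
apply: ge_ereal_sup => _ [g [Lg gf] <-].
apply: ge_ereal_sup => _ [t /[!halflineE] t0 <-].
rewrite lee_fin; have := hC f g N t N0 t0 Wf.
have -> : A g t = \sum_(0 <= k < N) coef alpha g k * nlaguerre alpha k t.
  rewrite /A/=/psi; apply: eq_big_nat => k /andP[_ kN].
  by rewrite /galerkin memOm kN.
move=> /le_trans; apply.
have := lnorm_sum_le p1 d0 N0 gf; rewrite subn0 => h.
rewrite (mulrC 2) -mulrA ler_wpM2l ?(ltW C0)//.
have : 0 <= N%:R `^ (- gam) by exact: powR_ge0.
lra.
Qed.

(** * Fooling functions and lower bounds *)

Definition lagsum (c : R) (l : seq nat) : R -> R :=
  horner (c *: \sum_(j <- l) nlagpoly alpha j).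

Lemma coef_lagsum c l k : uniq l ->
  coef alpha (lagsum c l) k = if k \in l then c else 0.
Proof.
move=> ul; rewrite coef_horner -scalerAl momZ// mulr_suml mom_sum//.
under eq_bigr do rewrite mom_nlagpoly//.
case: ifPn => [kl|kl].
  rewrite (bigD1_seq k)//= eqxx big1 ?addr0 ?mulr1// => j /negbTE jk.
  by rewrite jk.
rewrite big_seq big1 ?mulr0// => j jl.
by have [jk|//] := eqVneq j k; rewrite -jk jl in kl.
Qed.

Lemma crep_lagsum c l t : uniq l -> crep alpha (lagsum c l) t =
  c * \sum_(j <- l) nlaguerre alpha j t * Num.sqrt (weight alpha t).
Proof.
(* From [n] terms on the partial sums are constant; the successor is needed because a partial sum of
   length [n] stops at index [n - 1]. *)
move=> ul; pose n := (\max_(j <- l) j).+1.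
apply: cvg_lim => //; apply: cvg_near_cst; near=> m.
have nm : (n <= m)%N by near: m; exact: nbhs_infty_ge.
rewrite /series/= mulr_sumr.
transitivity (\sum_(0 <= k < m | k \in l)
    c * (nlaguerre alpha k t * Num.sqrt (weight alpha t))).
  rewrite [RHS]big_mkcond/=; apply: eq_bigr => k _.
  by rewrite coef_lagsum//; case: ifP => _; rewrite ?mul0r// mulrA.
rewrite -big_filter; apply: perm_big; apply: uniq_perm => //.
  by rewrite filter_uniq// iota_uniq.
move=> k; rewrite mem_filter mem_index_iota/=; case kl : (k \in l) => //=.
by rewrite (leq_trans _ nm)// ltnS leq_bigmax_seq.
Unshelve. all: by end_near. Qed.

(** The weighted norm is at most (2M)^(1/s) (3M)^mu |c|. *)
Lemma Wclass_lagsum c l (M : nat) : (0 < M)%N -> uniq l -> (size l <= 2 * M)%N ->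
  (forall k, k \in l -> (k <= 3 * M)%N) ->
  2 `^ recip s * 3 `^ mu * M%:R `^ (mu + recip s) * `|c| <= 1 ->
  Wclass alpha s mu (lagsum c l).
Proof.
move=> M0 ul sl lM hc; have M0' : 0 < M%:R :> R by rewrite ltr0n.
have /andP[s0 _] := recip_itv s1.
split; first exact: L2w_horner.
apply: (@le_trans _ _ ((size l)%:R `^ recip s * ((3 * M%:R) `^ mu * `|c|))%:E).
  apply: lnorm_supp_le => // k.
  rewrite normrM normr_id ger0_norm ?powR_ge0// coef_lagsum//.
  case: ifPn => kl; last by rewrite normr0 mulr0.
  rewrite ler_wpM2r// ge0_ler_powR ?nnegrE ?(ltW mu0)// -natrM ler_nat.
  by rewrite geq_max (leq_trans M0) ?leq_pmull// lM.
rewrite lee_fin; apply: le_trans hc.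
rewrite powRD; last by rewrite (gt_eqF M0') implybT.
rewrite powRM// [leRHS](_ : _ =
  (2 `^ recip s * M%:R `^ recip s) * (3 `^ mu * M%:R `^ mu * `|c|)); last by ring.
rewrite ler_wpM2r ?mulr_ge0 ?powR_ge0// -powRM//.
by rewrite ge0_ler_powR ?nnegrE// -natrM ler_nat.
Qed.

(** The method returns one value v for two targets u and -u at [t], and by the triangle inequality
    |u - v| or |u + v| is at least |u|. *)
Lemma recovery_error_ge (A : (R -> R) -> (R -> R)) (delta t : R) f f' g g' :
  0 < t -> Wclass alpha s mu f -> Wclass alpha s mu f' -> L2w alpha g -> L2w alpha g' ->
  (lnorm p (fun k => coef alpha g k - coef alpha f k)%R <= delta%:E)%E ->
  (lnorm p (fun k => coef alpha g' k - coef alpha f' k)%R <= delta%:E)%E ->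
  A g = A g' -> crep alpha f' t = - crep alpha f t ->
  (`|crep alpha f t|%:E <= recovery_error alpha s mu p delta A)%E.
Proof.
move=> t0 Wf Wf' Lg Lg' gf gf' Agg' cf'.
have key h e : Wclass alpha s mu h -> L2w alpha e ->
    (lnorm p (fun k => coef alpha e k - coef alpha h k)%R <= delta%:E)%E ->
    (`|crep alpha h t - A e t * Num.sqrt (weight alpha t)|%:E <=
      recovery_error alpha s mu p delta A)%E.
  move=> Wh Le eh.
  refine (le_trans _ (ereal_sup_ubound (ex_intro2 _ _ h Wh erefl))).
  refine (le_trans _ (ereal_sup_ubound (ex_intro2 _ _ e (conj Le eh) erefl))).
  by apply: ereal_sup_ubound; exists t => //; rewrite halflineE.
have := key _ _ Wf Lg gf; have := key _ _ Wf' Lg' gf'; rewrite cf' -Agg'.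
move: (crep alpha f t) (A g t * _) => u v h1 h2.
have [uv|uv] := leP `|u| `|u - v|; first by apply: le_trans h2; rewrite lee_fin.
apply: le_trans h1; rewrite lee_fin -opprD normrN.
have := ler_normD (u - v) (u + v).
rewrite addrACA addNr addr0 -mulr2n normrMn.
lra.
Qed.

(** At least [M] terms, each at least [c * c0] at the same point, add up without cancellation. *)
Lemma crep_lagsum_ge : exists2 c0 : R, 0 < c0 & forall c M l, 0 <= c -> (0 < M)%N ->
  uniq l -> (forall k, k \in l -> (M <= k <= 3 * M)%N) -> (M <= size l)%N ->
  c0 * (c * M%:R) <= `|crep alpha (lagsum c l) (16 * M%:R)^-1|.
Proof.
have [c0 c00 hc0] := nlaguerre_ge alpha0.
exists c0 => // c M l c_ge0 M0 ul lM sl; rewrite crep_lagsum//.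
set t := (16 * _)^-1.
have h : c0 * M%:R <= \sum_(j <- l) nlaguerre alpha j t * Num.sqrt (weight alpha t).
  apply: (@le_trans _ _ (\sum_(j <- l) c0)).
    rewrite big_const_seq count_predT iter_addr_0 -[c0 *+ _]mulr_natr.
    by rewrite ler_wpM2l ?(ltW c00)// ler_nat.
  rewrite big_seq [leRHS]big_seq; apply: ler_sum => j /lM /andP[Mj jM].
  by apply: hc0 => //; rewrite Mj (leq_trans jM)// leq_mul2r orbT.
have S0 : 0 <= \sum_(j <- l) nlaguerre alpha j t * Num.sqrt (weight alpha t).
  by apply: le_trans h; rewrite mulr_ge0 ?(ltW c00).
by rewrite ger0_norm ?mulr_ge0// mulrCA ler_wpM2l.
Qed.

(* With coefficient [height M], a [lagsum] over at most [2M] indices below [3M]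
   lies in the class. *)
Definition kappa : R := (2 `^ recip s * 3 `^ mu)^-1.

Let kappa0 : 0 < kappa.
Proof. by rewrite /kappa invr_gt0 mulr_gt0 ?powR_gt0. Qed.

Definition height (M : nat) : R := kappa * M%:R `^ (- (mu + recip s)).

Let height_ge0 M : 0 <= height M.
Proof. by rewrite mulr_ge0 ?powR_ge0 ?(ltW kappa0). Qed.

Let height_le1 M : (0 < M)%N ->
  2 `^ recip s * 3 `^ mu * M%:R `^ (mu + recip s) * `|height M| <= 1.
Proof.
move=> M0; have M0' : 0 < M%:R :> R by rewrite ltr0n.
rewrite ger0_norm ?height_ge0// /height powRN /kappa.
have u0 : 2 `^ recip s * 3 `^ mu != 0 :> R by rewrite gt_eqF// mulr_gt0 ?powR_gt0.
have v0 : M%:R `^ (mu + recip s) != 0 by rewrite gt_eqF// powR_gt0.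
by rewrite mulrACA divff// divff// mulr1.
Qed.

Let heightM M : (0 < M)%N -> height M * M%:R = kappa * M%:R `^ (- gam).
Proof.
move=> M0; have M0' : 0 < M%:R :> R by rewrite ltr0n.
rewrite /height -mulrA -[X in _ * (_ * X)]powRr1 ?ler0n// -powRD; last first.
  by rewrite (gt_eqF M0') implybT.
by congr (_ * _ `^ _); ring.
Qed.

Lemma lnorm0_le (delta : R) (x : nat -> R) : 0 <= delta -> (forall k, x k = 0) ->
  (lnorm p x <= delta%:E)%E.
Proof.
move=> d0 x0; have := @lnorm_supp_le R p x 0 [::] p1 (lexx 0) isT.
by rewrite mulr0 => h; apply: le_trans (h _) _ => // k; rewrite x0 normr0.
Qed.

Lemma galerkin_radius_ge : exists2 c : R, 0 < c &
  forall (N : nat) (delta : R), (0 < N)%N -> 0 < delta ->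
  ((c * N%:R `^ (- gam))%:E <= galerkin_radius alpha s mu p N delta)%E.
Proof.
have [c0 c00 hc0] := crep_lagsum_ge.
exists (c0 * kappa) => [|N delta N0 d0]; first by rewrite mulr_gt0.
apply: le_ereal_inf_tmp => _ [A [Om [psi [cOm _ ->]]] <-].
(* Of the 2N candidate indices at most [N] lie in [Omega], so at least [N] survive. *)
pose l := [seq k <- iota N (2 * N) | k \notin Om].
have ul : uniq l by rewrite filter_uniq// iota_uniq.
have lN k : k \in l -> (N <= k <= 3 * N)%N.
  by rewrite mem_filter mem_iota => /and3P[_ -> kN]; rewrite ltnW.
have sl2 : (size l <= 2 * N)%N.
  by rewrite size_filter (leq_trans (count_size _ _))// size_iota.
have sl1 : (N <= size l)%N.
  have : (count (mem Om) (iota N (2 * N)) <= N)%N.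
    apply: leq_trans cOm; rewrite -size_filter; apply: uniq_leq_size.
      by rewrite filter_uniq// iota_uniq.
    by move=> k; rewrite mem_filter => /andP[].
  have := count_predC (mem Om) (iota N (2 * N)); rewrite size_iota.
  rewrite size_filter mul2n -addnn => h cN.
  rewrite -(leq_add2l N); apply: leq_trans (leq_add cN (leqnn _)).
  by rewrite h.
have lOm k : k \in Om -> (k \in l) = false by rewrite mem_filter => ->.
have gal0 c : galerkin alpha Om (lagsum c l) = fun=> 0.
  apply/funext => k; rewrite /galerkin; case: ifPn => // kO.
  by rewrite coef_lagsum// lOm.
have W c : `|c| = `|height N| -> Wclass alpha s mu (lagsum c l).
  move=> hc; apply: (@Wclass_lagsum c l N) => //; last by rewrite hc; exact: height_le1.
  by move=> k /lN /andP[].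
have := hc0 (height N) N l (height_ge0 N) N0 ul lN sl1.
rewrite heightM// mulrA -lee_fin => /le_trans; apply.
(* The data are exact here: both functions already have zero information. *)
apply: (@recovery_error_ge _ _ _ _ (lagsum (- height N) l)
  (lagsum (height N) l) (lagsum (- height N) l)).
- by rewrite invr_gt0 mulr_gt0// ltr0n.
- exact: W.
- by apply: W; rewrite normrN.
- exact: L2w_horner.
- exact: L2w_horner.
- by apply: lnorm0_le => [|k]; [exact: ltW|rewrite subrr].
- by apply: lnorm0_le => [|k]; [exact: ltW|rewrite subrr].
- by rewrite /= !gal0.
- by rewrite !crep_lagsum// mulNr.
Qed.

Local Notation E := (mu - recip p + recip s).

Let E0 : 0 < E.
Proof. by have := recip_itv p1; move: hmu; lra. Qed.

(** The bound is uniform in [N]: the zero function is admissible data for two members of the class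
    of opposite sign, so no method distinguishes them, whatever it observes. *)
Lemma galerkin_radius_ge_noise : exists2 c : R, 0 < c &
  forall (N : nat) (delta : R), 0 < delta < 1 ->
  ((c * delta `^ (gam / E))%:E <= galerkin_radius alpha s mu p N delta)%E.
Proof.
have [c0 c00 hc0] := crep_lagsum_ge.
exists (c0 * kappa * 2 `^ (- gam)) => [|N delta /andP[d0 d1]].
  by rewrite !mulr_gt0 ?powR_gt0.
apply: le_ereal_inf_tmp => _ [A _ <-].
pose D := delta `^ (- (1 / E)).
have D1 : 1 <= D.
  by rewrite -[leLHS](powRr0 delta) ger_powR ?d0 ?(ltW d1)// oppr_le0 divr_ge0// ltW.
have D0 : 0 < D by rewrite (lt_le_trans _ D1).
(* D <= M <= 2D, as D >= 1. The lower bound hides the functions in the noise; the upper bound costs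
   only the factor 2^(-gam). *)
pose M := (Num.truncn D).+1.
have DM : D <= M%:R by exact/ltW/truncnS_gt.
have MD : M%:R <= 2 * D.
  have ME : M%:R = (Num.truncn D)%:R + 1 :> R by rewrite /M natr1.
  have : (Num.truncn D)%:R <= D by rewrite truncn_le ltW.
  lra.
have M0' : 0 < M%:R :> R by rewrite ltr0n.
pose l := iota M M.
have ul : uniq l by exact: iota_uniq.
have lN k : k \in l -> (M <= k <= 3 * M)%N.
  rewrite mem_iota => /andP[-> kM]; rewrite (leq_trans (ltnW kM))//.
  by rewrite addnn -mul2n leq_mul2r orbT.
have sl : size l = M by rewrite size_iota.
have W c : `|c| = `|height M| -> Wclass alpha s mu (lagsum c l).
  move=> hc; apply: (@Wclass_lagsum c l M) => //; last by rewrite hc; exact: height_le1.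
    by rewrite sl leq_pmull.
  by move=> k /lN /andP[].
(* The l_p norm of the difference is at most M^(1/p) times the height, hence at most M^(-E) <=
   D^(-E) = delta. *)
have noise c : `|c| = `|height M| ->
    (lnorm p (fun k => coef alpha (lagsum 0 [::]) k - coef alpha (lagsum c l) k)%R
      <= delta%:E)%E.
  move=> hc; apply: (@le_trans _ _ ((M%:R `^ recip p * `|c|)%:E)).
    rewrite -sl; apply: lnorm_supp_le => // k.
    by rewrite !coef_lagsum// in_nil sub0r normrN; case: ifP; rewrite ?normr0.
  rewrite lee_fin hc ger0_norm ?height_ge0// /height mulrCA -powRD; last first.
    by rewrite (gt_eqF M0') implybT.
  have k1 : kappa <= 1.
    have /andP[sr0 _] := recip_itv s1.
    rewrite /kappa invf_le1 ?mulr_gt0 ?powR_gt0// -[leLHS]mulr1.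
    rewrite ler_pM//; first by rewrite -[leLHS](powRr0 2) ler_powR// ler1n.
    by rewrite -[leLHS](powRr0 3) ler_powR ?(ltW mu0)// ler1n.
  apply: (@le_trans _ _ (M%:R `^ (- E))).
    rewrite (_ : recip p - (mu + recip s) = - E); last by ring.
    by rewrite ler_piMl// powR_ge0.
  have -> : delta = D `^ (- E).
    rewrite /D -powRrM (_ : - (1 / E) * - E = 1) ?powRr1 ?ltW//.
    by field; rewrite gt_eqF.
  rewrite !powRN lef_pV2 ?posrE ?powR_gt0//.
  by rewrite ge0_ler_powR ?nnegrE ?(ltW E0) ?(ltW D0).
have := hc0 (height M) M l (height_ge0 M) isT ul lN; rewrite sl => /(_ (leqnn _)).
rewrite heightM// => hv.
apply: (@le_trans _ _ (`|crep alpha (lagsum (height M) l) (16 * M%:R)^-1|%:E)).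
  rewrite lee_fin; apply: le_trans hv.
  rewrite -!mulrA ler_wpM2l ?(ltW c00)// ler_wpM2l ?(ltW kappa0)//.
  have -> : delta `^ (gam / E) = D `^ (- gam).
    by rewrite /D -powRrM; congr (_ `^ _); field; rewrite gt_eqF.
  rewrite -powRM ?(ltW D0)// !powRN lef_pV2 ?posrE ?powR_gt0 ?mulr_gt0//.
  by rewrite ge0_ler_powR ?nnegrE ?(ltW gam0) ?mulr_ge0 ?(ltW D0).
apply: (@recovery_error_ge _ _ _ _ (lagsum (- height M) l)
  (lagsum 0 [::]) (lagsum 0 [::])).
- by rewrite invr_gt0 mulr_gt0.
- exact: W.
- by apply: W; rewrite normrN.
- exact: L2w_horner.
- exact: L2w_horner.
- exact: noise.
- by apply: noise; rewrite normrN.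
- by [].
- by rewrite !crep_lagsum// mulNr.
Qed.

End radius_bounds.

(** * Matching the upper and lower bounds *)

Theorem theorem4p12 (R : realType) (alpha : R) (s p : \bar R) (mu : R)
  (halpha : 0 <= alpha)
  (hs : (1%:E <= s)%E) (hp : (1%:E <= p)%E)
  (hmu : 1 - recip s < mu) (hmu0 : 0 < mu) :
  (forall Nmin : R -> nat,
     (forall delta : R, 0 < delta < 1 -> (1 <= Nmin delta)%N) ->
     asymp (fun delta : R => ((Nmin delta)%:R)%:E)
           (fun delta : R =>
              (delta `^ (- (1 / (mu - recip p + recip s))))%:E) ->
     asymp (fun delta : R => inf_galerkin_radius alpha s mu p delta)
           (fun delta : R => galerkin_radius alpha s mu p (Nmin delta) delta) /\
     asymp (fun delta : R => galerkin_radius alpha s mu p (Nmin delta) delta)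
           (fun delta : R =>
              (delta `^ ((mu + recip s - 1) / (mu - recip p + recip s)))%:E))
  /\
  (forall N : R -> nat,
     (forall delta : R, 0 < delta < 1 -> (1 <= N delta)%N) ->
     asymp (fun delta : R => galerkin_radius alpha s mu p (N delta) delta)
           (fun delta : R => inf_galerkin_radius alpha s mu p delta) ->
     exists2 c : R, 0 < c &
       forall delta : R, 0 < delta < 1 ->
         c * delta `^ (- (1 / (mu - recip p + recip s))) <= (N delta)%:R).
Proof.
have [C C0 hC] := galerkin_radius_le halpha hs hp hmu hmu0.
have [c c0 hc] := galerkin_radius_ge halpha hs hp hmu0.
have [d d0 hd] := galerkin_radius_ge_noise halpha hs hp hmu hmu0.
have /andP[rp0 rp1] := recip_itv hp.
set gam := mu + recip s - 1 in hC hc hd *.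
set E := mu - recip p + recip s in hd *.
have gam0 : 0 < gam by rewrite /gam; lra.
have E0 : 0 < E by rewrite /E; lra.
pose D (delta : R) := delta `^ (- (1 / E)).
have D0 delta : 0 < delta -> 0 < D delta by move=> ?; exact: powR_gt0.
(* [DE1] and [DE2] express that [D] balances the truncation error D^(-gam) and the noise error
   D^(1-1/p) delta. *)
have DE1 delta : D delta `^ (- gam) = delta `^ (gam / E).
  by rewrite /D -powRrM; congr (_ `^ _); field; rewrite gt_eqF.
have DE2 delta : 0 < delta -> D delta `^ (1 - recip p) * delta = delta `^ (gam / E).
  move=> delta0; rewrite /D -powRrM -[X in _ * X](powRr1 (ltW delta0)) -powRD; last first.
    by rewrite (gt_eqF delta0) implybT.
  by congr (_ `^ _); rewrite /gam /E; field; rewrite gt_eqF.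
have infle (N : nat) (delta : R) : (1 <= N)%N ->
    (inf_galerkin_radius alpha s mu p delta <= galerkin_radius alpha s mu p N delta)%E.
  by move=> N1; apply: ereal_inf_lbound; exists N.
have infge (delta : R) : 0 < delta < 1 ->
    ((d * delta `^ (gam / E))%:E <= inf_galerkin_radius alpha s mu p delta)%E.
  by move=> dI; apply: le_ereal_inf_tmp => _ [N _ <-]; exact: hd.
(* For [N] comparable to [D], the bound N <= a1 D controls the noise term and D <= a2 N the
   truncation term. *)
have upper (Nm : R -> nat) :
    (forall delta : R, 0 < delta < 1 -> (1 <= Nm delta)%N) ->
    asymp (fun delta : R => ((Nm delta)%:R)%:E) (fun delta : R => (D delta)%:E) ->
    exists2 C' : R, 0 < C' & forall delta : R, 0 < delta < 1 ->
      (galerkin_radius alpha s mu p (Nm delta) delta <= (C' * delta `^ (gam / E))%:E)%E.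
  move=> Nm1 [a1 [a2 [a10 a20 Nasymp]]].
  exists (C * (a1 `^ (1 - recip p) + a2 `^ gam)) => [|delta dI].
    by rewrite mulr_gt0// addr_gt0// powR_gt0.
  have N1 := Nm1 _ dI; have [] := Nasymp _ dI; rewrite -!EFinM !lee_fin => ND DN.
  have /andP[delta0 _] := dI; have Dd := D0 _ delta0.
  have N0 : 0 < (Nm delta)%:R :> R by rewrite ltr0n.
  apply: (le_trans (hC _ _ N1 delta0)); rewrite lee_fin -mulrA ler_wpM2l ?(ltW C0)//.
  rewrite mulrDl lerD//.
    rewrite -(DE2 _ delta0) mulrA ler_wpM2r ?(ltW delta0)// -powRM ?(ltW a10) ?(ltW Dd)//.
    by rewrite ge0_ler_powR ?nnegrE ?subr_ge0 ?mulr_ge0 ?(ltW a10) ?(ltW Dd).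
  rewrite -DE1 !powRN ler_pdivlMr ?powR_gt0// mulrC ler_pdivrMr ?powR_gt0//.
  rewrite -powRM ?(ltW a20)//.
  by rewrite ge0_ler_powR ?nnegrE ?mulr_ge0 ?(ltW a20) ?(ltW Dd) ?(ltW gam0).
split=> [Nm Nm1 /(upper _ Nm1) [C' C'0 hC']|N N1 [a1 [a2 [a10 _ RN]]]].
  split.
    exists 1, (C' / d); split => //; first by rewrite divr_gt0.
    move=> delta dI; split; first by rewrite mul1e infle// Nm1.
    apply: (le_trans (hC' _ dI)); apply: le_trans (lee_wpmul2l _ (infge _ dI)).
      by rewrite -EFinM lee_fin mulrA divfK// gt_eqF.
    by rewrite lee_fin divr_ge0 ?ltW.
  exists C', d^-1; split => //; first by rewrite invr_gt0.
  move=> delta dI; split; first by rewrite -EFinM hC'.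
  apply: le_trans (lee_wpmul2l _ (le_trans (infge _ dI) (infle _ _ (Nm1 _ dI)))).
    by rewrite -EFinM lee_fin mulKf// gt_eqF.
  by rewrite lee_fin invr_ge0 ltW.
(* A reference choice with D <= N2 <= 2D, which bounds the infimum from above. *)
pose N2 delta := (Num.truncn (D delta)).+1.
have [C' C'0 hC'] : exists2 C' : R, 0 < C' & forall delta : R, 0 < delta < 1 ->
      (galerkin_radius alpha s mu p (N2 delta) delta <= (C' * delta `^ (gam / E))%:E)%E.
  apply: upper => //; exists 2, 1; split => // delta /andP[delta0 delta1].
  have Dge1 : 1 <= D delta.
    rewrite -[leLHS](powRr0 delta) ger_powR ?delta0 ?(ltW delta1)//.
    by rewrite oppr_le0 divr_ge0// ltW.
  rewrite -!EFinM !lee_fin mul1r; split; last exact/ltW/truncnS_gt.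
  have NE : (N2 delta)%:R = (Num.truncn (D delta))%:R + 1 :> R by rewrite /N2 natr1.
  have : (Num.truncn (D delta))%:R <= D delta by rewrite truncn_le (le_trans _ Dge1).
  lra.
(* The chain c N^(-gam) <= R_N <= a1 inf R <= a1 C' D^(-gam) yields N^gam >= b D^gam; taking the
   root of order [gam] gives the constant. *)
pose b := c / (a1 * C').
have b0 : 0 < b by rewrite divr_gt0// mulr_gt0.
exists (b `^ gam^-1) => [|delta dI]; first exact: powR_gt0.
have /andP[delta0 _] := dI.
have N0 : 0 < (N delta)%:R :> R by rewrite ltr0n N1.
have : c * (N delta)%:R `^ (- gam) <= a1 * C' * delta `^ (gam / E).
  rewrite -lee_fin; apply: (le_trans (hc _ _ (N1 _ dI) delta0)).
  apply: (le_trans (RN _ dI).1).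
  rewrite -mulrA EFinM lee_wpmul2l ?lee_fin ?(ltW a10)//.
  exact: le_trans (infle (N2 delta) delta isT) (hC' _ dI).
rewrite -DE1 => h.
have h1 : b * D delta `^ gam <= (N delta)%:R `^ gam.
  rewrite /b mulrAC ler_pdivrMr ?mulr_gt0// [leRHS]mulrC; move: h.
  by rewrite !powRN ler_pdivlMr ?powR_gt0 ?D0// mulrAC ler_pdivrMr ?powR_gt0.
have h3 (x : R) : 0 <= x -> (x `^ gam) `^ gam^-1 = x.
  by move=> x0; rewrite -powRrM divff ?gt_eqF// powRr1.
have h2 : (b * D delta `^ gam) `^ gam^-1 <= ((N delta)%:R `^ gam) `^ gam^-1.
  rewrite ge0_ler_powR ?nnegrE ?powR_ge0 ?invr_ge0 ?(ltW gam0)//.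
  by rewrite mulr_ge0 ?powR_ge0// ltW.
move: h2; rewrite powRM ?powR_ge0 ?(ltW b0)// !h3//.
by rewrite ltW// D0.
Qed.
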